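(* Let $R=\bigoplus_{\alpha\in\mathbb{Z}}R_\alpha$ be a $\mathbb{Z}$-graded Noetherian universally catenary domain. Then the following are equivalent: (a) $R$ is a graded perinormal domain. (b) $R$ is gr-$(R_1)$ and for each $\mathfrak{p}\in h\text{-Spec}(R)$, $R_{(\mathfrak{p})}$ is the only graded ring $S$ between $R_{(\mathfrak{p})}$ and $R_H$ such that the induced map $h\text{-Spec}(S)\to h\text{-Spec}(R_{(\mathfrak{p})})$ is an order-reflecting bijection. (c) $R$ is gr-$(R_1)$ and for each $\mathfrak{p}\in h\text{-Spec}(R)$, $R_{(\mathfrak{p})}$ is the only graded ring $S$ between $R_{(\mathfrak{p})}$ and its integral closure such that the induced map $h\text{-Spec}(S)\to h\text{-Spec}(R_{(\mathfrak{p})})$ is an order-reflecting bijection.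
   Context: A $\mathbb{Z}$-graded domain is an integral domain $R=\bigoplus_{\alpha\in\mathbb{Z}}R_\alpha$ with each $R_\alpha$ an additive subgroup and $R_\beta R_\gamma\subseteq R_{\beta+\gamma}$. Its graded quotient field is $R_H$, where $H$ is the set of nonzero homogeneous elements; $f/g$ (with $f,g$ homogeneous, $g\neq0$) has degree $\deg f-\deg g$. A graded overring of $R$ is a graded subring of $R_H$ containing $R$. $h\text{-Spec}(R)$ is the set of graded (homogeneous) prime ideals of $R$, ordered by inclusion, and $h\text{-Spec}^1(R)$ is the set of those of height one. For a graded prime $P$, $R_{(P)}$ is the localization of $R$ at the set of homogeneous elements not in $P$. The integral closure of a domain is its integral closure in its quotient field (for graded domains it lies in the graded quotient field and is a graded overring). The induced maps on $h\text{-Spec}$ are given by contraction; such a map $\varphi$ is order-reflecting if $\varphi(P)\subseteq\varphi(Q)$ implies $P\subseteq Q$. A graded maximal ideal is an ideal maximal among proper graded ideals; a graded domain is gr-local if it has exactly one graded maximal ideal. A graded overring $S$ of $R$ satisfies gGD (graded going-down) if whenever $P,Q\in h\text{-Spec}(R)$ and $\tilde Q\in h\text{-Spec}(S)$ with $P\subseteq Q$ and $\tilde Q\cap R=Q$, there exists $\tilde P\in h\text{-Spec}(S)$ with $\tilde P\subseteq\tilde Q$ and $\tilde P\cap R=P$. $R$ is a graded perinormal domain if every gr-local graded overring of $R$ satisfying gGD over $R$ is a localization of $R$ (i.e. equals $R_W$ for some multiplicative subset $W$ of $R$). A graded domain is a gr-valuation domain if for every nonzero homogeneous $x$ in its graded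 quotient field, $x$ or $x^{-1}$ lies in the domain. $R$ is gr-$(R_1)$ if $R_{(P)}$ is a gr-valuation domain for every $P\in h\text{-Spec}^1(R)$. *)

(* Defs.v *)
From HB Require Import structures.
From mathcomp Require Import all_boot all_order all_algebra.
From mathcomp Require Import boolp classical_sets functions.

Set Implicit Arguments.
Unset Strict Implicit.
Unset Printing Implicit Defensive.

Import GRing.Theory.
Local Open Scope classical_set_scope.
Local Open Scope ring_scope.

Definition is_subring (A : comNzRingType) (S : set A) : Prop :=
  subring_closed [in S].

(** Ideals of a subring [S] of [A] are sets of elements of [A]; [S := setT]
    gives the ideals of [A] itself. The improper ideal [S] is allowed. *)
Definition ideal (A : comNzRingType) (S I : set A) : Prop :=
  [/\ I `<=` S, I 0, (forall x y, I x -> I y -> I (x + y))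
    & forall a x, S a -> I x -> I (a * x)].

Definition prime_ideal (A : comNzRingType) (S P : set A) : Prop :=
  [/\ ideal S P, ~ P 1
    & forall x y, S x -> S y -> P (x * y) -> P x \/ P y].

Definition noetherian (A : comNzRingType) : Prop :=
  forall I : set A, ideal setT I ->
    exists s : seq A, I = smallest (ideal setT) [set` s].

(** [C 0], ..., [C n] is a strictly increasing chain of primes of [S]. *)
Definition prime_chain (A : comNzRingType) (S : set A) (n : nat)
    (C : nat -> set A) : Prop :=
  (forall i, (i <= n)%N -> prime_ideal S (C i)) /\
  (forall i, (i < n)%N -> C i `<` C i.+1).

Definition saturated_chain (A : comNzRingType) (S : set A) (n : nat)
    (C : nat -> set A) : Prop :=
  prime_chain S n C /\
  forall i, (i < n)%N ->
    ~ exists Q, [/\ prime_ideal S Q, C i `<` Q & Q `<` C i.+1].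

Definition height_is (A : comNzRingType) (S P : set A) (n : nat) : Prop :=
  (exists2 C, prime_chain S n C & C n = P) /\
  (forall m C, prime_chain S m C -> C m = P -> (m <= n)%N).

Definition catenary (A : comNzRingType) : Prop :=
  forall P Q : set A, prime_ideal setT P -> prime_ideal setT Q -> P `<=` Q ->
    (exists N, forall n C,
        prime_chain setT n C -> C 0%N = P -> C n = Q -> (n <= N)%N) /\
    (forall m n C D,
        saturated_chain setT m C -> C 0%N = P -> C m = Q ->
        saturated_chain setT n D -> D 0%N = P -> D n = Q -> m = n).

Definition finite_type (R A : comNzRingType) (f : {rmorphism R -> A}) : Prop :=
  exists s : seq A, smallest (@is_subring A) (range f `|` [set` s]) = setT.

Definition universally_catenary (R : comNzRingType) : Prop :=
  forall (A : comNzRingType) (f : {rmorphism R -> A}),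
    finite_type f -> catenary A.

(** The additive subset [X] is the sum of its intersections with the
    components [G a]. *)
Definition graded (V : zmodType) (G : int -> set V) (X : set V) : Prop :=
  forall x, X x -> exists (s : seq int) (f : int -> V),
    (forall a, G a (f a) /\ X (f a)) /\ x = \sum_(a <- s) f a.

(** [R] is the direct sum of the additive subgroups [G a], and
    [G a * G b] is contained in [G (a + b)]. *)
Definition grading (R : comNzRingType) (G : int -> set R) : Prop :=
  [/\ forall a, zmod_closed [in G a],
      forall a b x y, G a x -> G b y -> G (a + b) (x * y),
      graded G setT
    & forall (s : seq int) (f : int -> R), uniq s -> (forall a, G a (f a)) ->
        \sum_(a <- s) f a = 0 -> forall a, a \in s -> f a = 0].

(** Everything below takes place in the quotient field of [R]: a graded ring
    between [R] and its graded quotient field is a subset of [{fraction R}],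
    graded by the degrees [deg f - deg g] of fractions [f / g]. On the image of
    [R] these degrees agree with the given grading [G]. *)

Definition base (R : idomainType) : set {fraction R} :=
  range (@tofrac R).
Arguments base R : clear implicits.

Definition frac_deg (R : idomainType) (G : int -> set R) (a : int) :
    set {fraction R} :=
  [set z | exists b c f g,
     [/\ G b f, G c g, g != 0, a = b - c & z = tofrac f / tofrac g]].

Definition homogeneous (R : idomainType) (G : int -> set R) :
    set {fraction R} :=
  [set z | exists a, frac_deg G a z].

Definition loc (K : fieldType) (A W : set K) : set K :=
  [set x / w | x in A & w in W].

Definition mult_subset (K : fieldType) (A W : set K) : Prop :=
  [/\ W `<=` A, ~ W 0 & mulr_closed [in W]].

Definition gr_quotient (R : idomainType) (G : int -> set R)
    (A : set {fraction R}) : set {fraction R} :=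
  loc A [set x | [/\ A x, homogeneous G x & x <> 0]].

(** The graded ring [S] lies between [A] and [B]. *)
Definition graded_between (R : idomainType) (G : int -> set R)
    (A B S : set {fraction R}) : Prop :=
  [/\ is_subring S, graded (frac_deg G) S, A `<=` S & S `<=` B].

Definition graded_overring (R : idomainType) (G : int -> set R)
    (S : set {fraction R}) : Prop :=
  graded_between G (base R) (gr_quotient G (base R)) S.

Definition hSpec (R : idomainType) (G : int -> set R)
    (S : set {fraction R}) : set (set {fraction R}) :=
  [set P | prime_ideal S P /\ graded (frac_deg G) P].

Definition hSpec1 (R : idomainType) (G : int -> set R)
    (S : set {fraction R}) : set (set {fraction R}) :=
  [set P | hSpec G S P /\ height_is S P 1].

Definition gr_loc (R : idomainType) (G : int -> set R)
    (S P : set {fraction R}) : set {fraction R} :=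
  loc S [set x | [/\ S x, homogeneous G x & ~ P x]].

Definition graded_proper_ideal (R : idomainType) (G : int -> set R)
    (S I : set {fraction R}) : Prop :=
  [/\ ideal S I, graded (frac_deg G) I & I <> S].

Definition gr_maximal (R : idomainType) (G : int -> set R)
    (S M : set {fraction R}) : Prop :=
  graded_proper_ideal G S M /\
  forall I, graded_proper_ideal G S I -> M `<=` I -> I = M.

Definition gr_local (R : idomainType) (G : int -> set R)
    (S : set {fraction R}) : Prop :=
  exists! M, gr_maximal G S M.

Definition gGD (R : idomainType) (G : int -> set R)
    (A S : set {fraction R}) : Prop :=
  forall P Q Q', hSpec G A P -> hSpec G A Q -> hSpec G S Q' ->
    P `<=` Q -> Q' `&` A = Q ->
    exists P', [/\ hSpec G S P', P' `<=` Q' & P' `&` A = P].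

Definition graded_perinormal (R : idomainType) (G : int -> set R) : Prop :=
  forall S, graded_overring G S -> gr_local G S -> gGD G (base R) S ->
    exists2 W, mult_subset (base R) W & S = loc (base R) W.

Definition gr_valuation (R : idomainType) (G : int -> set R)
    (V : set {fraction R}) : Prop :=
  forall x, gr_quotient G V x -> homogeneous G x -> x <> 0 -> V x \/ V x^-1.

Definition gr_R1 (R : idomainType) (G : int -> set R) : Prop :=
  forall P, hSpec1 G (base R) P -> gr_valuation G (gr_loc G (base R) P).

Definition integral_closure (K : fieldType) (A : set K) : set K :=
  [set x | exists p : {poly K},
     [/\ p \is monic, p \is a polyOver [in A] & root p x]].

Definition contraction (K : fieldType) (A P : set K) : set K := P `&` A.

Definition hSpec_reflecting_bij (R : idomainType) (G : int -> set R)
    (A S : set {fraction R}) : Prop :=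
  set_bij (hSpec G S) (hSpec G A) (contraction A) /\
  forall P Q, hSpec G S P -> hSpec G S Q ->
    contraction A P `<=` contraction A Q -> P `<=` Q.

(** [A] is the only graded ring between [A] and [B] whose contraction map to
    [hSpec A] is an order-reflecting bijection. *)
Definition only_between (R : idomainType) (G : int -> set R)
    (A B : set {fraction R}) : Prop :=
  [set S | graded_between G A B S /\ hSpec_reflecting_bij G A S] = [set A].

(* Main.v *)
Require Import Defs.
From HB Require Import structures.
From mathcomp Require Import all_boot all_order all_algebra.
From mathcomp Require Import boolp classical_sets functions.
From mathcomp Require Import zify ring.

(** Let [A] denote the homogeneous localization of [R] at a graded prime [p].

    The main tool concerns a nonzero homogeneous [y] in the quotient field and
    a prime [Q] of [R[y]] containing [y]. By [krull_principal_ideal], a prime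
    [q] inside [Q] minimal over [y] has height one, and it is graded because
    minimal primes over homogeneous elements are ([minimal_over_graded]). Its
    contraction to [R] has height one too ([height_contraction]): the primes
    [0], kernel of [R['X] -> R[y]], preimage of [q] form a saturated chain of
    length 2 in the catenary ring [R['X]], and a prime strictly between [0] and
    the contraction would produce a longer chain with the same ends. When the
    localizations at graded height one primes are graded valuation rings, it
    follows that [y] is a fraction [u / s] over [R], where [u] lies in a height
    one prime contained in [Q] and [s] does not ([height_one_fraction]).

    Assume this condition on localizations and the uniqueness condition between
    [A] and its integral closure. Let [S] be a gr-local overring of [R] with
    going-down, with graded maximal ideal [M], and put [p := M `&` R]. Three
    facts show that [S = A].

    - Contraction from [S] reflects inclusions. If [y] is homogeneous in [Q1],
      write [y = u / s] as above with [u] in a height one prime [P] contained in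
      [Q1]. If [Q1 `&` R] is contained in [Q2], going-down gives a prime of [S]
      inside [Q2] that contracts to [P]; it contains [u = y * s] but not [s], so
      it contains [y] ([gGD_order_reflecting]).
    - [S] is integral over [A]. For [x] homogeneous in [S] and [y := x^-1],
      either [1] is in the ideal generated by [y] in [A[y]], which is an
      integral equation for [x], or [y] lies in a prime of [A[y]], and then
      [y = u / s] with [u] in a height one prime [P] contained in [p].
      Going-down gives a prime of [S] that contracts to [P] and contains
      [s = x * u], which is impossible ([gGD_integral]).
    - Contraction is onto, by going-down from [M] ([gGD_reflecting_bij]).

    Conversely let [R] be graded perinormal. Going-down over a graded prime [P]
    of height one is automatic, so a graded valuation overring centred on [P] is
    a localization of [R], hence equal to the homogeneous localization at [P]
    ([perinormal_R1]). An overring of [A] whose spectrum is that of [A] is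
    gr-local and has going-down, so it is a localization of [R], and comparing
    centres it is [A] ([perinormal_unique]). Both steps use that a graded ring
    which is a localization of [R] at some multiplicative set is contained in
    the homogeneous localization of [R] at the contraction of any of its graded
    primes ([graded_localization_sub]).

    The second condition implies the third because a graded ring inside the
    quotient field automatically lies in the graded quotient field. *)

Set Implicit Arguments.
Unset Strict Implicit.
Unset Printing Implicit Defensive.

Import GRing.Theory.
Local Open Scope classical_set_scope.
Local Open Scope ring_scope.

(** * Maximal members of families of sets *)

(** The form of Zorn's lemma for families that need not contain the empty set:
    only nonempty chains have to be bounded, in exchange for a starting member,
    which moreover ends up below the maximal one. *)
Lemma zorn_above (T : Type) (F : set (set T)) (X0 : set T) :
  F X0 ->
  (forall C, C !=set0 -> total_on C subset -> C `<=` F ->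
     F (\bigcup_(X in C) X)) ->
  exists M, [/\ F M, X0 `<=` M & forall X, F X -> M `<=` X -> X = M].
Proof.
move=> FX0 Fchain; pose P X := F (X `|` X0).
have [C CP Ctot|M [PM Mmax]] := @Zorn_bigcup T P.
  rewrite /P; have [C0|C0] := pselect (C !=set0); last first.
    rewrite (_ : \bigcup_(X in C) X = set0) ?set0U //.
    by apply/seteqP; split=> // x [X CX _]; case: C0; exists X.
  have -> : \bigcup_(X in C) X `|` X0
          = \bigcup_(X in [set X `|` X0 | X in C]) X.
    apply/seteqP; split=> x.
      case=> [[X CX Xx]|X0x]; first by exists (X `|` X0); [exists X|left].
      by have [X CX] := C0; exists (X `|` X0); [exists X|right].
    by case=> _ [X CX <-] [Xx|X0x]; [left; exists X|right].
  apply: Fchain.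
  - by have [X CX] := C0; exists (X `|` X0), X.
  - move=> _ _ [X CX <-] [Y CY <-].
    by case: (Ctot X Y CX CY) => sXY; [left|right]; apply: setSU.
  - by move=> _ [X CX <-]; apply: CP.
exists (M `|` X0); split=> // X FX sMX; apply/seteqP; split=> //.
suff -> : M = X by left.
apply: contrapT => neq; apply: (Mmax X).
  rewrite properEneq; split=> [|x Mx]; last by apply: sMX; left.
  by apply/eqP => eqMX; apply: neq.
by rewrite /P setUidl // => x X0x; apply: sMX; right.
Qed.

(** * Subrings and ideals given as sets *)

Section Subrings.
Variables (K : comNzRingType) (A : set K).

Lemma is_subringP :
  is_subring A <-> [/\ A 1, (forall x y, A x -> A y -> A (x - y))
                     & forall x y, A x -> A y -> A (x * y)].
Proof.
split=> [[A1 AB AM]|[A1 AB AM]]; split.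
- exact: set_mem.
- by move=> x y /mem_set Ax /mem_set Ay; apply/set_mem/AB.
- by move=> x y /mem_set Ax /mem_set Ay; apply/set_mem/AM.
- exact: mem_set.
- by move=> x y /set_mem Ax /set_mem Ay; apply/mem_set/AB.
- by move=> x y /set_mem Ax /set_mem Ay; apply/mem_set/AM.
Qed.

Hypothesis ringA : is_subring A.

Lemma subring1 : A 1. Proof. by case/is_subringP: ringA. Qed.

Lemma subringB x y : A x -> A y -> A (x - y).
Proof. by case/is_subringP: ringA => _ AB _; apply: AB. Qed.

Lemma subringM x y : A x -> A y -> A (x * y).
Proof. by case/is_subringP: ringA => _ _; apply. Qed.

Lemma subring0 : A 0.
Proof. by rewrite -(subrr 1); apply: subringB; apply: subring1. Qed.

Lemma subringN x : A x -> A (- x).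
Proof. by rewrite -sub0r; apply/subringB/subring0. Qed.

Lemma subringD x y : A x -> A y -> A (x + y).
Proof. by move=> Ax Ay; rewrite -(opprK y); apply/subringB/subringN. Qed.

Lemma subringX x n : A x -> A (x ^+ n).
Proof.
move=> Ax; elim: n => [|n IHn]; first exact: subring1.
by rewrite exprS; apply: subringM.
Qed.

Lemma subring_sum I (r : seq I) (P : pred I) f :
  (forall i, P i -> A (f i)) -> A (\sum_(i <- r | P i) f i).
Proof.
by move=> Af; apply: (big_ind A) => //; [apply: subring0|apply: subringD].
Qed.

Lemma ideal_self : ideal A A.
Proof.
split=> //; [exact: subring0|exact: subringD|exact: subringM].
Qed.

Lemma ideal_principal x : A x -> ideal A [set x * a | a in A].
Proof.
move=> Ax; split=> [_ [a Aa <-]||_ _ [a Aa <-] [b Ab <-]|a _ Aa [b Ab <-]].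
- exact: subringM.
- by exists 0; [apply: subring0|rewrite mulr0].
- by exists (a + b); [apply: subringD|rewrite mulrDr].
- by exists (a * b); [apply: subringM|rewrite mulrCA].
Qed.

Section Ideals.
Variable I : set K.
Hypothesis idI : ideal A I.

Lemma ideal_sub : I `<=` A. Proof. by case: idI. Qed.

Lemma ideal0 : I 0. Proof. by case: idI. Qed.

Lemma idealD x y : I x -> I y -> I (x + y).
Proof. by case: idI => _ _ ID _; apply: ID. Qed.

Lemma ideal_mull a x : A a -> I x -> I (a * x).
Proof. by case: idI => _ _ _; apply. Qed.

Lemma ideal_mulr a x : A a -> I x -> I (x * a).
Proof. by rewrite mulrC; apply: ideal_mull. Qed.

Lemma idealN x : I x -> I (- x).
Proof. by rewrite -mulN1r; apply/ideal_mull/subringN/subring1. Qed.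

Lemma idealB x y : I x -> I y -> I (x - y).
Proof. by move=> Ix Iy; apply/idealD/idealN. Qed.

Lemma ideal_sum T (r : seq T) (P : pred T) f :
  (forall i, P i -> I (f i)) -> I (\sum_(i <- r | P i) f i).
Proof.
by move=> If; apply: (big_ind I) => //; [apply: ideal0|apply: idealD].
Qed.

Lemma ideal1 : I 1 -> I = A.
Proof.
move=> I1; apply/seteqP; split=> [|x Ax]; first exact: ideal_sub.
by rewrite -(mulr1 x); apply: ideal_mull.
Qed.

Lemma ideal_addl J : ideal A J -> ideal A [set x + y | x in I & y in J].
Proof.
case=> sJ J0 JD JM; split.
- by move=> _ [x Ix] [y Jy] <-; apply: subringD; [apply: ideal_sub|apply: sJ].
- by exists 0; [apply: ideal0|exists 0; rewrite ?addr0].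
- move=> _ _ [x Ix] [y Jy] <- [x' Ix'] [y' Jy'] <-.
  by exists (x + x'); [apply: idealD|exists (y + y'); [apply: JD|rewrite addrACA]].
- move=> a _ Aa [x Ix] [y Jy] <-; rewrite mulrDr.
  by exists (a * x); [apply: ideal_mull|exists (a * y) => //; apply: JM].
Qed.

End Ideals.

Lemma ideal_chain (C : set (set K)) :
  C !=set0 -> total_on C subset -> C `<=` ideal A ->
  ideal A (\bigcup_(X in C) X).
Proof.
move=> [X CX] Ctot CI; split.
- by move=> x [Y CY]; apply: ideal_sub; apply: CI.
- by exists X => //; apply: ideal0; apply: CI.
- move=> x y [Y CY Yx] [Z CZ Zy].
  case: (Ctot Y Z CY CZ) => sYZ.
    by exists Z => //; apply: idealD => //; [apply: CI|apply: sYZ].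
  by exists Y => //; apply: idealD => //; [apply: CI|apply: sYZ].
- by move=> a x Aa [Y CY Yx]; exists Y => //; apply: ideal_mull => //; apply: CI.
Qed.

End Subrings.

(** * Noetherian subrings *)

Definition max_condition (K : comNzRingType) (A : set K) : Prop :=
  forall F : set (set K), F `<=` ideal A -> F !=set0 ->
    exists2 M, F M & forall X, F X -> M `<=` X -> X = M.

(** Generation is expressed by minimality among ideals, which is the form in
    which it passes to homomorphic images. *)
Definition finitely_generated (K : comNzRingType) (A I : set K) : Prop :=
  exists2 s : seq K, [set` s] `<=` I
    & forall J, ideal A J -> [set` s] `<=` J -> I `<=` J.

Lemma chain_seq (T : eqType) (C : set (set T)) (s : seq T) :
  C !=set0 -> total_on C subset -> [set` s] `<=` \bigcup_(X in C) X ->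
  exists2 X, C X & [set` s] `<=` X.
Proof.
move=> [X0 CX0] Ctot; elim: s => [|a s IHs] sC; first by exists X0.
have [|X CX sX] := IHs; first by move=> x /= xs; apply: sC; rewrite /= inE xs orbT.
have [|Y CY Ya] := sC a; first by rewrite /= inE eqxx.
case: (Ctot X Y CX CY) => sXY.
  by exists Y => // x /=; rewrite inE => /orP[/eqP->//|/sX/sXY].
by exists X => // x /=; rewrite inE => /orP[/eqP->|/sX//]; apply: sXY.
Qed.

Lemma fg_max_condition (K : comNzRingType) (A : set K) : is_subring A ->
  (forall I, ideal A I -> finitely_generated A I) -> max_condition A.
Proof.
move=> ringA fgA F FI [X0 FX0].
have [C C0 Ctot CF|M [FM _ Mmax]] := zorn_above FX0; last by exists M.
have idU : ideal A (\bigcup_(X in C) X).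
  by apply: ideal_chain => // X /CF/FI.
have [s sU Us] := fgA _ idU.
have [X CX sX] := chain_seq C0 Ctot sU.
suff -> : \bigcup_(X in C) X = X by apply: CF.
apply/seteqP; split=> [|x Xx]; last by exists X.
by apply: Us => //; apply/FI/CF.
Qed.

(** ** Hilbert's basis theorem *)

Definition lincomb (K : comNzRingType) (a : nat -> K) (n : nat) : set K :=
  [set x | exists c : nat -> K, x = \sum_(i < n) c i * a i].

Lemma ideal_lincomb (K : comNzRingType) (a : nat -> K) n :
  ideal setT (lincomb a n).
Proof.
split=> //.
- by exists (fun=> 0); rewrite big1 // => i _; rewrite mul0r.
- move=> _ _ [c ->] [d ->]; exists (fun i => c i + d i).
  by rewrite -big_split; apply: eq_bigr => i _; rewrite mulrDl.
- move=> b _ _ [c ->]; exists (fun i => b * c i).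
  by rewrite big_distrr; apply: eq_bigr => i _ /=; rewrite mulrA.
Qed.

Lemma lincombS (K : comNzRingType) (a : nat -> K) m n : (m <= n)%N ->
  lincomb a m `<=` lincomb a n.
Proof.
move=> le_mn _ [c ->]; exists (fun i => if (i < m)%N then c i else 0).
rewrite (big_ord_widen n (fun i => c i * a i)) // big_mkcond.
by apply: eq_bigr => i _; case: ifP => _; rewrite ?mul0r.
Qed.

Lemma mem_lincomb (K : comNzRingType) (a : nat -> K) n i : (i < n)%N ->
  lincomb a n (a i).
Proof.
move=> lt_in; exists (fun j => (j == i)%:R).
rewrite (bigD1 (Ordinal lt_in)) //= eqxx mul1r big1 ?addr0 // => j ne.
by rewrite (_ : (j == i :> nat) = false) ?mul0r //; apply/negbTE.
Qed.

(** An infinite sequence would otherwise give a strictly increasing chain of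
    ideals, whose union is generated by finitely many elements and hence
    already by some term. *)
Lemma noetherian_lincomb (K : comNzRingType) (a : nat -> K) : noetherian K ->
  exists n, lincomb a n (a n).
Proof.
move=> noethK; pose C := range (lincomb a).
have C0 : C !=set0 by exists (lincomb a 0), 0%N.
have Ctot : total_on C subset.
  move=> _ _ [m _ <-] [n _ <-].
  by case/orP: (leq_total m n) => ?; [left|right]; apply: lincombS.
have idT : is_subring [set: K] by apply/is_subringP; split.
have idU : ideal setT (\bigcup_(X in C) X).
  by apply: ideal_chain => // _ [n _ <-]; apply: ideal_lincomb.
have [s defU] := noethK _ idU.
have [|_ [n _ <-] sn] := chain_seq C0 Ctot (s := s).
  by rewrite defU => x sx I [_]; apply.
exists n; have : (\bigcup_(X in C) X) (a n).
  by exists (lincomb a n.+1); [exists n.+1|apply: mem_lincomb].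
by rewrite defU; apply; split=> //; apply: ideal_lincomb.
Qed.

(** If [J] were not finitely generated, one could choose [f 0], [f 1], ... in
    [J], each of least degree outside the ideal of the earlier ones. The leading
    coefficient of some [f n] is a combination of the earlier ones, so its
    leading term can be cancelled, against the choice of [f n]. *)
Lemma hilbert_basis (R : comNzRingType) (J : set {poly R}) :
  noetherian R -> ideal setT J -> finitely_generated setT J.
Proof.
move=> noethR idJ; apply: contrapT => nfg.
have idT : is_subring [set: {poly R}] by apply/is_subringP; split.
pose gen (s : seq {poly R}) := lincomb (nth 0 s) (size s).
have next (s : seq {poly R}) : exists f, [set` s] `<=` J ->
    [/\ J f, ~ gen s f
      & forall g, J g -> ~ gen s g -> (size f <= size g)%N].
  have [sJ|] := pselect ([set` s] `<=` J); last by exists 0.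
  have [f [Jf ngf]] : exists f, J f /\ ~ gen s f.
    apply: contrapT => no; apply: nfg; exists s => // I idI sI f Jf.
    have [c ->] : gen s f by apply: contrapT => ngf; apply: no; exists f.
    apply: (ideal_sum idI) => i _; apply: (ideal_mull idI) => //.
    by apply: sI => /=; apply: mem_nth.
  pose P n := `[< exists g, [/\ J g, ~ gen s g & size g = n] >].
  have exP : exists n, P n by exists (size f); apply/asboolP; exists f.
  case: (ex_minnP exP) => n /asboolP[g [Jg ngg <-]] gmin.
  exists g => _; split=> // h Jh ngh; apply: gmin; apply/asboolP.
  by exists h.
have [nx nxP] := choice next.
pose L := fix L n := if n is m.+1 then rcons (L m) (nx (L m)) else [::].
pose f n := nx (L n).
have sizeL n : size (L n) = n by elim: n => //= n; rewrite size_rcons => ->.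
have LJ n : [set` L n] `<=` J.
  elim: n => [|n IHn] x //=; rewrite mem_rcons inE => /orP[/eqP->|/IHn//].
  by case: (nxP _ IHn).
have nthL n i : (i < n)%N -> (L n)`_i = f i.
  elim: n => // n IHn; rewrite ltnS leq_eqVlt /= nth_rcons sizeL.
  case/orP=> [/eqP->|lt_in]; first by rewrite ltnn eqxx.
  by rewrite lt_in IHn.
have genL n : gen (L n) = lincomb f n.
  rewrite /gen sizeL; apply/seteqP.
  split=> _ [c ->]; exists c; apply: eq_bigr => i _; by rewrite nthL.
have fP n : [/\ J (f n), ~ lincomb f n (f n)
    & forall g, J g -> ~ lincomb f n g -> (size (f n) <= size g)%N].
  by rewrite -genL; apply/nxP/LJ.
have le_size m n : (m <= n)%N -> (size (f m) <= size (f n))%N.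
  move=> le_mn; have [Jfn nfn _] := fP n; have [_ _ ->] // := fP m.
  by apply: contra_not nfn; apply: lincombS.
have [n [c lcE]] := noetherian_lincomb (fun n => lead_coef (f n)) noethR.
have [Jfn nfn fmin] := fP n.
have fn0 : f n != 0.
  by apply/eqP => fn0; apply: nfn; rewrite fn0; apply: ideal0 (ideal_lincomb f n).
pose h : {poly R} := \sum_(i < n) (c i *: 'X^(size (f n) - size (f i))) * f i.
have hspan : lincomb f n h.
  by exists (fun i => c i *: 'X^(size (f n) - size (f i))).
have ngh : ~ lincomb f n (f n - h).
  move=> sp; apply: nfn; rewrite -(subrK h (f n)).
  exact: (idealD (ideal_lincomb f n)) sp hspan.
have Jh : J h.
  by apply: (ideal_sum idJ) => i _; apply: (ideal_mull idJ) => //; case: (fP i).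
have := fmin _ (idealB idT idJ Jfn Jh) ngh.
rewrite leqNgt => /negP; apply.
have szfn : size (f n) = (size (f n)).-1.+1.
  by rewrite prednK // size_poly_gt0.
rewrite szfn ltnS; apply/leq_sizeP => j le_j.
have nth_h k : h`_((size (f n)).-1 + k) =
    \sum_(i < n) c i * (f i)`_((size (f i)).-1 + k).
  rewrite coef_sum; apply: eq_bigr => i _.
  have [fi0|fi0] := eqVneq (f i) 0; first by rewrite fi0 mulr0 !coef0 mulr0.
  rewrite -scalerAl coefZ coefXnM.
  have lei := le_size _ _ (ltnW (ltn_ord i)).
  have szi : (0 < size (f i))%N by rewrite size_poly_gt0.
  have -> : ((size (f n)).-1 + k < size (f n) - size (f i))%N = false.
    by apply/negbTE; lia.
  by congr (_ * _`_ _); lia.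
rewrite coefB -(subnKC le_j) nth_h.
case: (j - _)%N => [|k].
  rewrite addn0 -[(f n)`_ _]/(lead_coef (f n)) lcE.
  apply/eqP; rewrite subr_eq0; apply/eqP.
  by apply: eq_bigr => i _; rewrite addn0.
have le_size_pred (p : {poly R}) : (size p <= (size p).-1 + k.+1)%N.
  by rewrite addnS; apply: leq_trans (leqSpred _) _; rewrite ltnS leq_addr.
by rewrite nth_default // big1 ?subrr // => i _; rewrite nth_default ?mulr0.
Qed.

(** * Prime ideals *)

Section Primes.
Variables (K : comNzRingType) (A P : set K).
Hypotheses (ringA : is_subring A) (primeP : prime_ideal A P).

Lemma prime_ideal_ideal : ideal A P. Proof. by case: primeP. Qed.

Lemma primeNM x y : A x -> A y -> ~ P x -> ~ P y -> ~ P (x * y).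
Proof. by case: primeP => _ _ PM Ax Ay nx ny /PM[]. Qed.

Lemma prime_contraction (B : set K) : is_subring B -> B `<=` A ->
  prime_ideal B (P `&` B).
Proof.
move=> ringB sBA; have [idP P1 PM] := primeP; split.
- split.
  + by move=> x [].
  + by split; [apply: ideal0 idP|apply: subring0].
  + by move=> x y [Px Bx] [Py By]; split; [apply: (idealD idP)|apply: subringD].
  + move=> a x Ba [Px Bx]; split; last exact: subringM.
    by apply: (ideal_mull idP) => //; apply: sBA.
- by case.
- move=> x y Bx By [Pxy _].
  by case: (PM x y (sBA _ Bx) (sBA _ By) Pxy); [left|right].
Qed.

End Primes.

Definition minimal_over (K : comNzRingType) (A : set K) (x : K) (P : set K) :
    Prop :=
  [/\ prime_ideal A P, P x
    & forall Q, prime_ideal A Q -> Q x -> Q `<=` P -> Q = P].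

(** The intersection of a nonempty chain of primes is prime. Zorn's lemma is
    applied to complements. *)
Lemma minimal_over_exists (K : comNzRingType) (A : set K) (x : K) (P : set K) :
  prime_ideal A P -> P x -> exists2 Q, minimal_over A x Q & Q `<=` P.
Proof.
move=> primeP Px.
pose F := [set X : set K | prime_ideal A (~` X) /\ (~` X) x].
have FP : F (~` P) by split; rewrite setCK.
have [C [X0 CX0] Ctot CF|M [[primeM Mx] sPM Mmax]] := zorn_above FP; last first.
  exists (~` M); last by rewrite -(setCK P); apply: subsetC.
  split=> // Q primeQ Qx sQM; rewrite -(setCK Q); congr (~` _).
  by apply: Mmax; [split; rewrite setCK|rewrite -(setCK M); apply: subsetC].
have prC X : C X -> prime_ideal A (~` X) by case/CF.
have prI X : C X -> ideal A (~` X) by case/prC.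
have inC z : (~` \bigcup_(X in C) X) z <-> forall X, C X -> (~` X) z.
  by split=> [nz X CX Xz|nz [X CX]]; [apply: nz; exists X|apply: nz].
split; last by apply/inC => X /CF[].
split; first split.
- by move=> z /inC/(_ _ CX0); apply: ideal_sub; case: (prC _ CX0).
- by apply/inC => X /prI/ideal0.
- by move=> y z /inC yC /inC zC; apply/inC => X CX; apply: (idealD (prI X CX)); auto.
- by move=> a z Aa /inC zC; apply/inC => X CX; apply: (ideal_mull (prI X CX)); auto.
- by move=> /inC/(_ _ CX0); case: (prC _ CX0).
move=> y z Ay Az /inC yzC.
apply: contrapT => /not_orP[/inC ny /inC nz].
have [Y [CY Yy]] : exists Y, C Y /\ Y y.
  by apply: contrapT => no; apply: ny => X CX Xy; apply: no; exists X.
have [Z [CZ Zz]] : exists Z, C Z /\ Z z.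
  by apply: contrapT => no; apply: nz => X CX Xz; apply: no; exists X.
case: (Ctot Y Z CY CZ) => sYZ.
  by case: (prC _ CZ) => _ _ /(_ _ _ Ay Az (yzC _ CZ))[]; apply=> //; apply: sYZ.
by case: (prC _ CY) => _ _ /(_ _ _ Ay Az (yzC _ CY))[]; apply=> //; apply: sYZ.
Qed.
(** * Krull's principal ideal theorem *)

Section Saturation.
Variables (K : comNzRingType) (A : set K).
Hypothesis ringA : is_subring A.

(** Saturated ideals at [q] are the contractions of ideals of the localization
    at [q]. Using them keeps the proof of the principal ideal theorem inside
    [A]. *)
Definition saturated (q J : set K) : Prop :=
  forall s t, A s -> ~ q s -> A t -> J (s * t) -> J t.

(** The contraction of the extension of [I] to the localization at [q]. *)
Definition satur (q I : set K) : set K :=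
  [set t | A t /\ exists s, [/\ A s, ~ q s & I (s * t)]].

Definition colon (J : set K) (a : K) : set K := [set t | A t /\ J (t * a)].

Lemma ideal_satur q I : prime_ideal A q -> ideal A I -> ideal A (satur q I).
Proof.
move=> primeq idI; have [_ q1 _] := primeq; split.
- by move=> t [].
- split; first exact: subring0.
  by exists 1; rewrite mulr0; split; [apply: subring1| |apply: ideal0 idI].
- move=> t u [At [s [As qs Ist]]] [Au [r [Ar qr Iru]]].
  split; first exact: subringD.
  exists (s * r); split; [exact: subringM|exact: (primeNM primeq)|].
  rewrite mulrDr; apply: (idealD idI); last first.
    by rewrite -mulrA; apply: (ideal_mull idI).
  by rewrite mulrAC; apply: (ideal_mulr idI).
- move=> a t Aa [At [s [As qs Ist]]]; split; first exact: subringM.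
  by exists s; split=> //; rewrite mulrCA; apply: (ideal_mull idI).
Qed.

Lemma sub_satur q I : prime_ideal A q -> ideal A I -> I `<=` satur q I.
Proof.
move=> [_ q1 _] idI t It; split; first exact: ideal_sub It.
by exists 1; rewrite mul1r; split; first exact: subring1.
Qed.

Lemma satur_saturated p q I : prime_ideal A p -> p `<=` q ->
  saturated q (satur p I).
Proof.
move=> primep spq s t As qs At [_ [r [Ar pr Irst]]]; split=> //.
exists (r * s); rewrite -mulrA; split=> //; first exact: subringM.
by apply: (primeNM primep) => // /spq.
Qed.

Lemma satur_sub q I J : saturated q J -> I `<=` J -> satur q I `<=` J.
Proof. by move=> satJ sIJ t [At [s [As qs /sIJ]]]; apply: satJ. Qed.

Lemma ideal_colon J a : A a -> ideal A J -> ideal A (colon J a).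
Proof.
move=> Aa idJ; split.
- by move=> t [].
- by split; [apply: subring0|rewrite mul0r; apply: ideal0 idJ].
- move=> t u [At Jt] [Au Ju]; split; first exact: subringD.
  by rewrite mulrDl; apply: (idealD idJ).
- move=> b t Ab [At Jt]; split; first exact: subringM.
  by rewrite -mulrA; apply: (ideal_mull idJ).
Qed.

Lemma colon_saturated q J a : A a -> saturated q J -> saturated q (colon J a).
Proof.
move=> Aa satJ s t As qs At [_ Jsta]; split=> //.
by apply: satJ qs _ _; [|apply: subringM|rewrite mulrA].
Qed.

Definition add_principal (I : set K) (a : K) : set K :=
  [set u + v | u in I & v in [set a * c | c in A]].

Lemma ideal_add_principal I a : ideal A I -> A a ->
  ideal A (add_principal I a).
Proof. by move=> idI Aa; apply: ideal_addl => //; apply: ideal_principal. Qed.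

Lemma sub_add_principal I a : I `<=` add_principal I a.
Proof.
move=> u Iu; exists u => //; exists 0; last by rewrite addr0.
by exists 0; [apply: subring0|rewrite mulr0].
Qed.

Lemma mem_add_principal I a : ideal A I -> add_principal I a a.
Proof.
move=> idI; exists 0; first exact: ideal0 idI.
by exists a; [exists 1; [apply: subring1|rewrite mulr1]|rewrite add0r].
Qed.

Lemma add_principal_sub I J a : ideal A J -> I `<=` J -> J a ->
  add_principal I a `<=` J.
Proof.
move=> idJ sIJ Ja _ [u /sIJ Ju] [_ [c Ac <-]] <-.
by apply: (idealD idJ) => //; apply: (ideal_mulr idJ).
Qed.

End Saturation.

Section Krull.
Variables (K : idomainType) (A : set K).
Hypotheses (ringA : is_subring A) (maxA : max_condition A).
Variables (x : K) (q : set K).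
Hypothesis minq : minimal_over A x q.

Let primeq : prime_ideal A q. Proof. by case: minq. Qed.
Let idq : ideal A q. Proof. by case: primeq. Qed.
Let qx : q x. Proof. by case: minq. Qed.
Let Ax : A x. Proof. exact: ideal_sub qx. Qed.

(** For [I] containing [x] these are the descending chains of ideals in an
    Artinian quotient of the localization at [q]. *)
Definition chain_above (I : set K) (J : nat -> set K) : Prop :=
  forall n, [/\ ideal A (J n), saturated A q (J n), J n.+1 `<=` J n
              & I `<=` J n].

Lemma chain_above_le I J m n : chain_above I J -> (m <= n)%N -> J n `<=` J m.
Proof.
move=> chJ; elim: n => [|n IHn]; first by rewrite leqn0 => /eqP->.
rewrite leq_eqVlt => /orP[/eqP->//|/IHn sJ].
by have [_ _ sJn _] := chJ n; apply: subset_trans sJ.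
Qed.

(** Noetherian induction on [I]. When [I] is prime, the saturated proper ideals
    above it can only be [q]. Otherwise [a * b] is in [I] for some [a], [b]
    outside [I], and [J n] is controlled by the sum of [J n] and [(a)], which
    lies above [I + (a)], and by the quotient of [J n] by [a], which lies above
    [I + (b)]. *)
Lemma saturated_dcc I J : ideal A I -> I x -> chain_above I J ->
  exists N, forall n, (N <= n)%N -> J N `<=` J n.
Proof.
pose stable (J : nat -> set K) :=
  exists N, forall n : nat, (N <= n)%N -> J N `<=` J n.
move=> idI0 I0x chJ0; apply: contrapT => unstable.
pose F := [set I | [/\ ideal A I, I x & exists2 J, chain_above I J & ~ stable J]].
have FI0 : F I by split=> //; exists J.
have [| |] := @maxA F; first by move=> ? [].
  by exists I.
move=> {I J chJ0 unstable FI0 idI0 I0x} I [idI Ix [J chJ unstable]] Imax.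
have stab a J' : A a -> ~ I a -> chain_above (add_principal A I a) J' -> stable J'.
  move=> Aa nIa chJ'; apply: contrapT => unstable'; apply: nIa.
  rewrite -(Imax (add_principal A I a)); [|split|].
  - exact: mem_add_principal.
  - exact: ideal_add_principal.
  - exact: sub_add_principal.
  - by exists J'.
  - exact: sub_add_principal.
have idJ n : ideal A (J n) by case: (chJ n).
have satJ n : saturated A q (J n) by case: (chJ n).
have sIJ n : I `<=` J n by case: (chJ n).
have [[N nJ1]|allJ1] := pselect (exists N, ~ J N 1); last first.
  apply: unstable; exists 0%N => n _; rewrite (ideal1 (idJ n)).
    exact: ideal_sub.
  by apply: contrapT => nJ1; apply: allJ1; exists n.
have [primeI|] := pselect (prime_ideal A I).
  have sJq n : (N <= n)%N -> J n `<=` q.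
    move=> le_Nn t Jt; apply: contrapT => qt; apply: nJ1.
    apply: chain_above_le chJ le_Nn _ _; apply: satJ qt _ _.
    - exact: ideal_sub Jt.
    - exact: subring1.
    - by rewrite mulr1.
  have [_ _ minI] := minq.
  apply: unstable; exists N => n le_Nn.
  rewrite -[J n]setUid; apply: subset_trans (sJq N _) _ => //.
  rewrite -(minI I) //; last exact: subset_trans (sIJ N) (sJq N _).
  by rewrite setUid.
apply; split=> // [/sIJ//|a b Aa Ab Iab]; apply: contrapT => /not_orP[nIa nIb].
pose J1 n := satur A q (add_principal A (J n) a); pose J2 n := colon A (J n) a.
have chJ1 : chain_above (add_principal A I a) J1.
  move=> n; have idJa m : ideal A (add_principal A (J m) a).
    exact: ideal_add_principal.
  split; [exact: ideal_satur|exact: satur_saturated| |].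
    apply: satur_sub; first exact: satur_saturated.
    apply: add_principal_sub; first exact: ideal_satur.
    - apply: subset_trans (sub_satur ringA primeq (idJa n)).
      apply: subset_trans (sub_add_principal ringA _).
      by case: (chJ n).
    - by apply: sub_satur => //; apply: mem_add_principal.
  apply: subset_trans (sub_satur ringA primeq (idJa n)).
  apply: add_principal_sub => //; last exact: mem_add_principal.
  exact: subset_trans (sIJ n) (sub_add_principal ringA _).
have chJ2 : chain_above (add_principal A I b) J2.
  move=> n; split; [exact: ideal_colon|exact: colon_saturated| |].
    by move=> t [At Jt]; split=> //; case: (chJ n) => _ _ sJ _; apply: sJ.
  apply: add_principal_sub; first exact: ideal_colon.
    move=> t It; split; first exact: ideal_sub It.
    by apply/sIJ/(ideal_mulr idI).
  by split=> //; rewrite mulrC; apply: sIJ.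
have [N1 J1N] := stab _ _ Aa nIa chJ1; have [N2 J2N] := stab _ _ Ab nIb chJ2.
apply: unstable; exists (maxn N1 N2) => n; rewrite geq_max => /andP[le1 le2] j Jj.
have Jle := chain_above_le chJ.
have : J1 N1 j.
  apply: sub_satur => //; first exact: ideal_add_principal.
  by apply: sub_add_principal => //; apply: Jle Jj; apply: leq_maxl.
move=> /(J1N _ le1)[Aj [s [As qs [j' Jj' [_ [c Ac <-]] defsj]]]].
have Jac : J (maxn N1 N2) (c * a).
  rewrite mulrC -[a * c](addKr j') defsj addrC; apply: (idealB ringA (idJ _)).
    exact: (ideal_mull (idJ _)).
  by apply: Jle Jj'; rewrite geq_max le1 le2.
have : J2 N2 c by split=> //; apply: Jle Jac; apply: leq_maxr.
move=> /(J2N _ le2)[_ Jca]; apply: satJ qs _ _ => //.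
by rewrite -defsj; apply: (idealD (idJ n)) => //; rewrite mulrC.
Qed.

(** Suppose [p] contains [y != 0] and let [J n] be the contraction of the ideal
    generated by [y ^+ n] in the localization at [p]. The sums of [J n] and
    [(x)] stabilize, which gives [J N = J N.+1 + x * J N] locally at [q], since
    [x] is invertible at [p]. Nakayama's lemma yields [J N = J N.+1], so that
    [y] is invertible at [p], which is absurd. *)
Theorem krull_principal_ideal (p : set K) :
  prime_ideal A p -> p `<=` q -> p <> q -> p = [set 0].
Proof.
move=> primep spq npq; have [idp p1 pM] := primep.
have npx : ~ p x by move=> px; apply: npq; case: minq => _ _; apply.
apply/seteqP; split=> [y py|_ ->]; last exact: ideal0 idp.
apply: contrapT => /eqP y0; have Ay : A y by apply: ideal_sub py.
pose J n := satur A p [set y ^+ n * c | c in A].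
have idyn n : ideal A [set y ^+ n * c | c in A].
  by apply: ideal_principal => //; apply: subringX.
have idJ n : ideal A (J n) by apply: ideal_satur.
have satJ n : saturated A q (J n) by apply: satur_saturated.
have Jx n c : A c -> J n (x * c) -> J n c.
  by apply: (@satur_saturated _ _ ringA p p) => //.
have sJ n : J n.+1 `<=` J n.
  move=> t [At [s [As ps [c Ac defst]]]]; split=> //; exists s; split=> //.
  by exists (y * c); [apply: subringM|rewrite -defst exprSr mulrA].
pose L n := satur A q (add_principal A (J n) x).
have idJx n : ideal A (add_principal A (J n) x) by apply: ideal_add_principal.
have chL : chain_above (add_principal A [set 0] x) L.
  move=> n; split; [exact: ideal_satur|exact: satur_saturated| |].
    apply: satur_sub; first exact: satur_saturated.
    apply: add_principal_sub; first exact: ideal_satur.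
    - apply: subset_trans (sub_satur ringA primeq (idJx n)).
      exact: subset_trans (sub_add_principal ringA _).
    - by apply: sub_satur => //; apply: mem_add_principal.
  apply: subset_trans (sub_satur ringA primeq (idJx n)).
  apply: add_principal_sub => //; last exact: mem_add_principal.
  by move=> _ ->; apply: ideal0 (idJx n).
have id0 : ideal A [set 0].
  split=> // [_ ->|_ _ -> ->|a _ _ ->]; rewrite ?addr0 ?mulr0 //.
  exact: subring0.
have [||N LN] := saturated_dcc _ _ chL.
- exact: ideal_add_principal.
- exact: mem_add_principal.
have JL z : J N z -> exists s w c,
    [/\ A s, ~ q s, J N.+1 w, J N c & s * z = w + x * c].
  move=> Jz; have : L N z.
    by apply: sub_satur => //; apply: sub_add_principal.
  move=> /(LN _ (leqnSn N))[Az [s [As qs [w Jw [_ [c Ac <-]] defsz]]]].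
  exists s, w, c; split=> //; apply: Jx => //.
  rewrite -[x * c](addKr w) defsz addrC; apply: (idealB ringA (idJ N)).
    exact: (ideal_mull (idJ N)).
  exact: sJ.
have sJN : J N `<=` J N.+1.
  (* Nakayama's lemma: [M] is maximal among the proper submodules of [J N] above
     [J N.+1], so multiplication by [x] kills the simple quotient. *)
  apply: contrapT => nsJ.
  pose F := [set X | [/\ ideal A X, saturated A q X, J N.+1 `<=` X, X `<=` J N
                       & ~ (J N `<=` X)]].
  have [| |M [idM satM sJM sMJ /existsNP[z /not_implyP[Jz nMz]]] Mmax] := @maxA F.
  - by move=> ? [].
  - by exists (J N.+1); split=> //; apply: sJ.
  have idMz : ideal A (add_principal A M z).
    by apply: ideal_add_principal => //; apply: ideal_sub Jz.
  have sMz := subset_trans (@sub_add_principal _ _ ringA M z)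
                (sub_satur ringA primeq idMz).
  have sJMz : J N `<=` satur A q (add_principal A M z).
    apply: contrapT => nsJMz; apply: nMz; rewrite -(Mmax _ _ sMz).
      by apply: sub_satur => //; apply: mem_add_principal.
    split=> //; [exact: ideal_satur|exact: satur_saturated| |].
      exact: subset_trans sMz.
    by apply: satur_sub => //; apply: add_principal_sub.
  have [s [w [c [As qs Jw Jc defsz]]]] := JL z Jz.
  have [Ac [r [Ar qr [m Mm [_ [d Ad <-]] defrc]]]] := sJMz _ Jc.
  apply: nMz; apply: (satM (s * r - x * d)).
  - by apply: subringB => //; apply: subringM.
  - move=> qsr; apply: (primeNM primeq As Ar qs qr).
    rewrite -(subrK (x * d) (s * r)); apply: (idealD idq) => //.
    exact: (ideal_mulr idq).
  - exact: ideal_sub Jz.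
  have -> : (s * r - x * d) * z = r * w + x * m.
    rewrite mulrBl (mulrC s) -mulrA defsz mulrDr.
    rewrite (_ : r * (x * c) = x * (r * c)); last by rewrite mulrCA.
    by rewrite -defrc mulrDr (mulrC z) !mulrA; ring.
  by apply: (idealD idM); apply: (ideal_mull idM) => //; apply: sJM.
have JyN : J N (y ^+ N).
  apply: sub_satur => //; exists 1; [exact: subring1|by rewrite mulr1].
have [_ [s [As ps [c Ac]]]] := sJN _ JyN.
rewrite exprSr -mulrA (mulrC s) => /(mulfI (expf_neq0 N y0)) defs.
by apply: ps; rewrite -defs; apply: (ideal_mulr idp).
Qed.

End Krull.

(** * Graded subgroups *)

Definition additive_set (V : zmodType) (X : set V) : Prop :=
  X 0 /\ forall x y, X x -> X y -> X (x - y).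

Section AdditiveSet.
Variables (V : zmodType) (X : set V).
Hypothesis addX : additive_set X.

Lemma additiveD x y : X x -> X y -> X (x + y).
Proof.
case: addX => X0 XB Xx Xy; rewrite -(opprK y); apply: (XB) => //.
by rewrite -sub0r; apply: XB.
Qed.

Lemma additive_sum I (r : seq I) (P : pred I) f :
  (forall i, P i -> X (f i)) -> X (\sum_(i <- r | P i) f i).
Proof.
by move=> Xf; apply: (big_ind X) => //; [case: addX|apply: additiveD].
Qed.

End AdditiveSet.

Lemma subring_additive (K : comNzRingType) (A : set K) :
  is_subring A -> additive_set A.
Proof. by move=> ringA; split; [apply: subring0|apply: subringB]. Qed.

Lemma ideal_additive (K : comNzRingType) (A I : set K) :
  is_subring A -> ideal A I -> additive_set I.
Proof. by move=> ringA idI; split; [apply: ideal0 idI|apply: idealB idI]. Qed.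

Lemma ideal_graded0 (V : zmodType) (G : int -> set V) :
  (forall a, additive_set (G a)) -> graded G [set 0].
Proof.
move=> addG _ ->; exists [::], (fun=> 0); rewrite big_nil; split=> // a.
by split=> //; case: (addG a).
Qed.

(** The components of a graded ring sitting inside [K]: their sum is direct but
    need not be all of [K], as happens for the homogeneous fractions in the
    quotient field. *)
Definition graded_pieces (K : comNzRingType) (G : int -> set K) : Prop :=
  [/\ forall a, additive_set (G a),
      G 0 1,
      forall a b x y, G a x -> G b y -> G (a + b) (x * y)
    & forall (s : seq int) (f : int -> K), uniq s -> (forall a, G a (f a)) ->
        \sum_(a <- s) f a = 0 -> forall a, a \in s -> f a = 0].

Lemma sum_fibers (V : zmodType) I (r : seq I) (d : I -> int) (z : I -> V)
    (D : seq int) : uniq D -> {subset map d r <= D} ->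
  \sum_(a <- D) \sum_(i <- r | d i == a) z i = \sum_(i <- r) z i.
Proof.
move=> uniqD; elim: r => [|i r IHr] sD.
  by rewrite big_nil big1 // => a _; rewrite big_nil.
rewrite big_cons -IHr; last by move=> a ra; apply: sD; rewrite inE ra orbT.
have Di : d i \in D by apply: sD; rewrite inE eqxx.
rewrite !(bigD1_seq (d i) Di uniqD) /= big_cons eqxx addrA; congr (_ + _).
by apply: eq_bigr => a ne; rewrite big_cons eq_sym (negbTE ne).
Qed.

Lemma max_seq (s : seq int) : s != [::] ->
  exists2 a, a \in s & forall i, i \in s -> (i <= a)%R.
Proof.
case: s => // a s _; elim: s a => [|b s IHs] a.
  by exists a; rewrite ?inE // => i; rewrite inE => /eqP->.
have [c cs maxc] := IHs b.
have [le_ac|lt_ca] := boolP (a <= c)%R.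
  by exists c => [|i]; rewrite inE ?cs ?orbT // => /orP[/eqP->|/maxc].
exists a => [|i]; rewrite inE ?eqxx // => /orP[/eqP->|/maxc le_ic] //.
by lia.
Qed.

Lemma graded_pieceX (K : comNzRingType) (G : int -> set K) a x n :
  graded_pieces G -> G a x -> G (a *+ n) (x ^+ n).
Proof.
case=> _ G1 GM _ Gx; elim: n => [|n IHn]; first by rewrite mulr0n expr0.
by rewrite mulrS exprS; apply: GM.
Qed.

Section Graded.
Variables (K : comNzRingType) (G : int -> set K).
Hypothesis gradK : graded_pieces G.

Let addG a : additive_set (G a). Proof. by case: gradK. Qed.
Let GM a b x y : G a x -> G b y -> G (a + b) (x * y).
Proof. by case: gradK => _ _ GM _; apply: GM. Qed.

Lemma graded_sum (X : set K) I (r : seq I) (d : I -> int) (z : I -> K) :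
  additive_set X -> (forall i, G (d i) (z i) /\ X (z i)) ->
  exists (s : seq int) (f : int -> K), [/\ uniq s,
    (forall a, G a (f a) /\ X (f a)) & \sum_(i <- r) z i = \sum_(a <- s) f a].
Proof.
move=> addX Xz; exists (undup (map d r)), (fun a => \sum_(i <- r | d i == a) z i).
split; first exact: undup_uniq.
- move=> a; split; apply: additive_sum => // i; last by case: (Xz i).
  by move=> /eqP<-; case: (Xz i).
- by rewrite sum_fibers ?undup_uniq // => a; rewrite mem_undup.
Qed.

(** The terms of degree [e] have the same sum in every homogeneous decomposition
    of an element, in particular in one whose terms lie in [X]. *)
Lemma graded_component (X : set K) I (r : seq I) (d : I -> int) (z : I -> K) e :
  additive_set X -> graded G X -> (forall i, G (d i) (z i)) ->
  X (\sum_(i <- r) z i) -> X (\sum_(i <- r | d i == e) z i).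
Proof.
move=> addX gradX Gz Xz; have [s [f [Gf defz]]] := gradX _ Xz.
pose h a := \sum_(i <- r | d i == a) z i - \sum_(b <- s | b == a) f b.
pose D := undup (e :: map d r ++ s).
have [_ _ _ Gind] := gradK.
have Gh a : G a (h a).
  apply: (proj2 (addG a)); apply: additive_sum => // i /eqP<- //.
  by case: (Gf i).
have sumh : \sum_(a <- D) h a = 0.
  rewrite sumrB !sum_fibers ?undup_uniq ?defz ?subrr ?map_id // => a.
    by rewrite mem_undup inE mem_cat orbC => ->; rewrite orbT.
  by rewrite mem_undup inE mem_cat => ->; rewrite orbT.
have /eqP : h e = 0.
  by apply: (Gind _ _ (undup_uniq _) Gh sumh); rewrite mem_undup inE eqxx.
rewrite subr_eq0 => /eqP->.
by apply: additive_sum => // a _; case: (Gf a).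
Qed.

Lemma graded_uniq (X : set K) x : additive_set X -> graded G X -> X x ->
  exists (s : seq int) (f : int -> K), [/\ uniq s,
    (forall a, G a (f a) /\ X (f a)) & x = \sum_(a <- s) f a].
Proof.
move=> addX gradX /gradX[s [f [Gf ->]]]; exact: (@graded_sum X _ s id f addX Gf).
Qed.

Lemma graded_sub (X Y : set K) : graded G X -> additive_set Y ->
  (forall a x, G a x -> X x -> Y x) -> X `<=` Y.
Proof.
move=> gradX addY sXY x /gradX[s [f [Gf ->]]]; apply: additive_sum => // a _.
by case: (Gf a) => Ga Xa; apply: (sXY a).
Qed.

Lemma graded_cap (X Y : set K) : additive_set X -> additive_set Y ->
  graded G X -> graded G Y -> graded G (X `&` Y).
Proof.
move=> addX addY gradX gradY x [Xx Yx].
have [s [f [Gf defx]]] := gradX _ Xx.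
exists (undup s), (fun a => \sum_(b <- s | b == a) f b); split=> [a|].
  split; first by apply: additive_sum => // b /eqP<-; case: (Gf b).
  split; first by apply: additive_sum => // b _; case: (Gf b).
  apply: (@graded_component Y _ s id f) => //; last by rewrite -defx.
  by move=> b; case: (Gf b).
by rewrite (@sum_fibers _ _ s id) ?undup_uniq // => a; rewrite map_id mem_undup.
Qed.

Lemma graded_add (X Y : set K) : graded G X -> graded G Y ->
  additive_set X -> additive_set Y ->
  graded G [set x + y | x in X & y in Y].
Proof.
move=> gradX gradY [X0 XB] [Y0 YB].
move=> _ [x /gradX[s [f [Gf ->]]]] [y /gradY[t [g [Gg ->]]]] <-.
have addXY : additive_set [set x + y | x in X & y in Y].
  split; first by exists 0 => //; exists 0; rewrite ?addr0.
  move=> _ _ [u Xu] [v Yv] <- [u' Xu'] [v' Yv'] <-.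
  exists (u - u'); first exact: XB.
  by exists (v - v'); [apply: YB|rewrite opprD addrACA].
pose r := [seq (true, a) | a <- s] ++ [seq (false, a) | a <- t].
have [p|u [h [_ Gh defh]]] := @graded_sum _ (bool * int)%type r snd
  (fun p => if p.1 then f p.2 else g p.2) addXY.
  case: p => [[] a] /=.
    case: (Gf a) => Ga Xa; split=> //.
    by exists (f a) => //; exists 0; rewrite ?addr0.
  case: (Gg a) => Ga Ya; split=> //.
  by exists 0 => //; exists (g a); rewrite ?add0r.
by exists u, h; split=> //; rewrite -defh big_cat !big_map.
Qed.

(** For a graded ideal, primality can be tested on homogeneous elements: the
    product of the two leading components is the leading component of the
    product, since [int] is totally ordered. *)
Lemma graded_prime (S P : set K) : is_subring S -> graded G S -> ideal S P ->
  graded G P -> ~ P 1 ->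
  (forall a b x y, G a x -> G b y -> S x -> S y -> P (x * y) -> P x \/ P y) ->
  prime_ideal S P.
Proof.
move=> ringS gradS idP gradP P1 hprime; split=> // x y Sx Sy.
have addP := ideal_additive ringS idP; have addS := subring_additive ringS.
have [s [f [us Gf ->]]] := graded_uniq addS gradS Sx.
have [t [g [ut Gg ->]]] := graded_uniq addS gradS Sy.
have [n le_n] := ubnP (size s + size t)%N.
elim: n s t us ut le_n {x y Sx Sy} => // n IHn s t us ut le_n.
have [->|s0] := eqVneq s [::]; first by left; rewrite big_nil; apply: ideal0 idP.
have [->|t0] := eqVneq t [::]; first by right; rewrite big_nil; apply: ideal0 idP.
have [a sa maxa] := max_seq s0; have [b tb maxb] := max_seq t0.
pose x := \sum_(i <- rem a s) f i; pose y := \sum_(i <- rem b t) g i.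
have defx : \sum_(i <- s) f i = f a + x by rewrite (big_rem a sa).
have defy : \sum_(i <- t) g i = g b + y by rewrite (big_rem b tb).
rewrite defx defy => Pxy.
have Sx : S x by apply: additive_sum => // i _; case: (Gf i).
have Sy : S y by apply: additive_sum => // i _; case: (Gg i).
have [[Ga Sa] [Gb Sb]] := (Gf a, Gg b).
have lts i : i \in rem a s -> (i < a)%R.
  by rewrite mem_rem_uniq // inE => /andP[ne /maxa]; lia.
have ltt i : i \in rem b t -> (i < b)%R.
  by rewrite mem_rem_uniq // inE => /andP[ne /maxb]; lia.
have Pab : P (f a * g b).
  pose F (p : int * int) := f p.1 * g p.2.
  pose r := [seq (i, j) | i <- a :: rem a s, j <- b :: rem b t].
  have <- : \sum_(p <- r | p.1 + p.2 == a + b) F p = f a * g b.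
    rewrite big_mkcond big_allpairs_dep big_cons /= [X in _ + X]big1_seq.
      rewrite addr0 big_cons /= eqxx big1_seq ?addr0 // => j /andP[_ /ltt lt_j].
      by case: eqP => // e; lia.
    move=> i /andP[_ /lts lt_i]; rewrite big1_seq // => j /andP[_].
    by rewrite inE => /orP[/eqP->|/ltt lt_j]; case: eqP => // e; lia.
  apply: (@graded_component P _ r (fun p => p.1 + p.2) F) => //.
    by case=> i j; apply: GM; [case: (Gf i)|case: (Gg j)].
  rewrite big_allpairs_dep /F /=; under eq_bigr do rewrite -big_distrr /=.
  by rewrite -big_distrl !big_cons.
have size_rems : (size (rem a s)).+1 = size s.
  by rewrite size_rem // prednK //; case: (s) s0.
have size_remt : (size (rem b t)).+1 = size t.
  by rewrite size_rem // prednK //; case: (t) t0.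
case: (hprime _ _ _ _ Ga Gb Sa Sb Pab) => [Pa|Pb].
  have : P x \/ P (g b + y).
    rewrite -defy; apply: (IHn (rem a s) t) => //.
    - exact: rem_uniq.
    - by move: le_n; rewrite -size_rems addSn ltnS.

    rewrite -/x defy -(addKr (f a) x) mulrDl mulNr addrC.
    apply: (idealB ringS idP) => //; apply: (ideal_mulr idP) => //.
    exact: subringD.
  by case=> [Px|]; [left; apply: (idealD idP)|right].
have : P (f a + x) \/ P y.
  rewrite -defx; apply: (IHn s (rem b t)) => //.
  - exact: rem_uniq.
  - by move: le_n; rewrite -size_remt addnS ltnS.
  rewrite -/y defx -(addKr (g b) y) mulrDr mulrN addrC.
  apply: (idealB ringS idP) => //; apply: (ideal_mull idP) => //.
  exact: subringD.
by case=> [|Py]; [left|right; apply: (idealD idP)].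
Qed.

(** ** The graded core of a prime ideal *)

Definition graded_core (P : set K) : set K :=
  [set x | exists (s : seq int) (f : int -> K),
     (forall a, G a (f a) /\ P (f a)) /\ x = \sum_(a <- s) f a].

Lemma graded_coreP (P : set K) I (r : seq I) (d : I -> int) (z : I -> K) :
  additive_set P -> (forall i, G (d i) (z i) /\ P (z i)) ->
  graded_core P (\sum_(i <- r) z i).
Proof.
move=> addP Pz; have [s [f [_ Gf ->]]] := graded_sum r addP Pz.
by exists s, f.
Qed.

Lemma mem_graded_core (P : set K) a x : additive_set P -> G a x -> P x ->
  graded_core P x.
Proof.
move=> addP Gx Px; have := @graded_coreP P unit [:: tt] (fun=> a) (fun=> x) addP.
by rewrite big_seq1; apply.
Qed.

Lemma graded_core_sub (P : set K) : additive_set P -> graded_core P `<=` P.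
Proof.
by move=> addP _ [s [f [Pf ->]]]; apply: additive_sum => // a _; case: (Pf a).
Qed.

Lemma graded_core_additive (P : set K) : additive_set P ->
  additive_set (graded_core P).
Proof.
move=> addP; have [P0 PB] := addP; split.
  exists [::], (fun=> 0); rewrite big_nil; split=> // a.
  by split=> //; case: (addG a).
move=> _ _ [s [f [Pf ->]]] [t [g [Pg ->]]].
have := @graded_coreP P (bool * int)%type
  ([seq (true, a) | a <- s] ++ [seq (false, a) | a <- t]) snd
  (fun p => if p.1 then f p.2 else - g p.2) addP.
rewrite big_cat !big_map /= sumrN; apply=> -[[] a] //=.
have [[G0 GB] [Ga Pa]] := (addG a, Pg a).
by rewrite -sub0r; split; [apply: GB|apply: PB].
Qed.

Lemma graded_core_graded (P : set K) : additive_set P ->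
  graded G (graded_core P).
Proof.
move=> addP _ [s [f [Pf ->]]]; exists s, f; split=> // a.
by case: (Pf a) => Ga Pa; split=> //; apply: (@mem_graded_core _ a).
Qed.

Lemma graded_core_ideal (S P : set K) : is_subring S -> graded G S ->
  ideal S P -> ideal S (graded_core P).
Proof.
move=> ringS gradS idP; have addP := ideal_additive ringS idP; split.
- by apply: subset_trans (graded_core_sub addP) _; apply: ideal_sub.
- by case: (graded_core_additive addP).
- by move=> x y; apply: (additiveD (graded_core_additive addP)).
- move=> _ _ /gradS[s [f [Gf ->]]] [t [g [Pg ->]]].
  have := @graded_coreP P (int * int)%type [seq (i, j) | i <- s, j <- t]
    (fun p => p.1 + p.2) (fun p => f p.1 * g p.2) addP.
  rewrite big_allpairs_dep /= big_distrl /=.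
  under eq_bigr do rewrite -big_distrr /=.
  apply=> -[i j] /=; case: (Gf i) => Gi Si; case: (Pg j) => Gj Pj.
  by split; [apply: GM|apply: (ideal_mull idP)].
Qed.

Lemma graded_core_prime (S P : set K) : is_subring S -> graded G S ->
  prime_ideal S P -> prime_ideal S (graded_core P).
Proof.
move=> ringS gradS [idP P1 PM]; have addP := ideal_additive ringS idP.
have sP := graded_core_sub addP.
apply: graded_prime => //; first exact: graded_core_ideal.
- exact: graded_core_graded.
- by move/sP.
move=> a b x y Gx Gy Sx Sy /sP/(PM _ _ Sx Sy)[Px|Py].
  by left; apply: (@mem_graded_core _ a).
by right; apply: (@mem_graded_core _ b).
Qed.

(** The graded core of [P] is again a prime containing the homogeneous [x]. *)
Lemma minimal_over_graded (S P : set K) a x : is_subring S -> graded G S ->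
  G a x -> minimal_over S x P -> graded G P.
Proof.
move=> ringS gradS Gx [primeP Px minP].
have addP := ideal_additive ringS (prime_ideal_ideal primeP).
rewrite -(minP (graded_core P)); first exact: graded_core_graded.
- exact: graded_core_prime.
- exact: (@mem_graded_core _ a).
- exact: graded_core_sub.
Qed.

End Graded.

(** * Adjoining an element to a subring *)

Definition adjoin (K : comNzRingType) (A : set K) (y : K) : set K :=
  [set z | exists2 p : {poly K}, forall i, A p`_i & z = p.[y]].

Section Adjoin.
Variables (K : comNzRingType) (A : set K) (y : K).

Lemma adjoin_additive (X : set K) : additive_set X -> additive_set (adjoin X y).
Proof.
move=> [X0 XB]; split.
  by exists 0; rewrite ?horner0 // => i; rewrite coef0.
move=> _ _ [p Xp ->] [q Xq ->]; exists (p - q); last by rewrite hornerD hornerN.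
by move=> i; rewrite coefB; apply: XB.
Qed.

Lemma adjoin_mul (I : set K) : is_subring A -> ideal A I ->
  forall u v, adjoin A y u -> adjoin I y v -> adjoin I y (u * v).
Proof.
move=> ringA idI _ _ [p Ap ->] [q Iq ->]; exists (p * q); last by rewrite hornerM.
move=> i; rewrite coefM; apply: (ideal_sum idI) => j _.
exact: (ideal_mull idI).
Qed.

Lemma sub_adjoin : A 0 -> A `<=` adjoin A y.
Proof.
move=> A0 x Ax; exists x%:P; last by rewrite hornerC.
by move=> i; rewrite coefC; case: ifP.
Qed.

Lemma mem_adjoin : A 0 -> A 1 -> adjoin A y y.
Proof.
move=> A0 A1; exists 'X; last by rewrite hornerX.
by move=> i; rewrite coefX; case: eqP.
Qed.

Lemma adjoin_subring : is_subring A -> is_subring (adjoin A y).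
Proof.
move=> ringA; apply/is_subringP; split.
- by apply: sub_adjoin; [apply: subring0|apply: subring1].
- by apply: (proj2 (adjoin_additive _)); apply: subring_additive.
- by apply: adjoin_mul => //; apply: ideal_self.
Qed.

Lemma adjoin_ideal (I : set K) : is_subring A -> ideal A I ->
  ideal (adjoin A y) (adjoin I y).
Proof.
move=> ringA idI; have addI := ideal_additive ringA idI; split.
- by move=> _ [p Ip ->]; exists p => // i; apply: ideal_sub (Ip i).
- by case: (adjoin_additive addI).
- by move=> u v; apply: (additiveD (adjoin_additive addI)).
- exact: adjoin_mul.
Qed.

Lemma adjoin_min (B : set K) : is_subring B -> A `<=` B -> B y ->
  adjoin A y `<=` B.
Proof.
move=> ringB sAB By _ [p Ap ->]; rewrite horner_coef; apply: subring_sum => // i _.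
by apply: subringM => //; [apply: sAB|apply: subringX].
Qed.

Lemma adjoin_graded (G : int -> set K) a : graded_pieces G -> is_subring A ->
  graded G A -> G a y -> graded G (adjoin A y).
Proof.
move=> gradK ringA gradA Gy; have ringAy := adjoin_subring ringA.
have addAy := subring_additive ringAy.
move=> _ [p Ap ->]; rewrite horner_coef.
apply: (additive_sum (graded_core_additive gradK addAy)) => i _.
have [s [f [Gf ->]]] := gradA _ (Ap i); rewrite big_distrl /=.
apply: (@graded_coreP _ _ gradK _ _ s (fun b => b + a *+ i)
  (fun b => f b * y ^+ i) addAy) => b.
have [_ _ GM _] := gradK; have [Gb Ab] := Gf b.
split; first by apply: GM => //; apply: graded_pieceX.
apply: subringM => //; first by apply: sub_adjoin => //; apply: subring0.
apply: subringX => //.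
by apply: mem_adjoin; [apply: subring0|apply: subring1].
Qed.

End Adjoin.

Lemma max_condition_image (B K : comNzRingType) (f : {rmorphism B -> K})
    (A : set K) :
  is_subring A -> range f = A ->
  (forall I, ideal [set: B] I -> finitely_generated setT I) -> max_condition A.
Proof.
move=> ringA rangef fgB; apply: fg_max_condition => // I idI.
have Af b : A (f b) by rewrite -rangef; exists b.
have pre J : ideal A J -> ideal [set: B] (f @^-1` J).
  move=> idJ; split=> //=.
  - by rewrite rmorph0; apply: ideal0 idJ.
  - by move=> x y Jx Jy; rewrite rmorphD; apply: (idealD idJ).
  - by move=> b x _ Jx; rewrite rmorphM; apply: (ideal_mull idJ).
have [s sI Is] := fgB _ (pre _ idI); exists (map f s).
  by move=> _ /mapP[b /sI Ib ->].
move=> J idJ sJ x Ix; have := ideal_sub idI Ix; rewrite -rangef => -[b _ fb].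
rewrite -fb in Ix *; apply: (Is _ (pre _ idJ)) Ix => c sc.
by apply: sJ; apply: map_f.
Qed.

(** * Sums of integral elements *)

Section IntegralSum.
Variables (K : fieldType) (A : set K).

(** The subring as a type, so that sums of elements integral over a ring type
    become available. *)
Record subring_type (ringA : is_subring A) :=
  SubringElt { subring_val :> K; _ : subring_val \in [in A] }.

Variable ringA : is_subring A.

HB.instance Definition _ := [isSub for @subring_val ringA].
HB.instance Definition _ := [Choice of subring_type ringA by <:].
HB.instance Definition _ :=
  GRing.SubChoice_isSubComNzRing.Build K [in A] (subring_type ringA) ringA.

Lemma integral_closureP x :
  integral_closure A x <-> integralOver (val : subring_type ringA -> K) x.
Proof.
split=> [[p [mp Ap px]]|[p mp px]]; last first.
  exists (map_poly val p); split=> //; first exact: monic_map.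
  apply/allP => _ /(nthP 0)[i _ <-]; rewrite coef_map /=. exact: (valP p`_i).
have Ai i : p`_i \in A.
  have [lt_i|le_i] := ltnP i (size p); first by apply: (allP Ap); apply: mem_nth.
  rewrite nth_default //; apply: mem_set; exact: subring0.
pose q := \poly_(i < size p) (Sub (p`_i) (Ai i) : subring_type ringA).
have defp : map_poly val q = p.
  apply/polyP => i; rewrite coef_map coef_poly; case: ltnP => [//|le_i].
  by rewrite nth_default.
exists q; last by rewrite defp.
have lcq : val (lead_coef q) = 1.
  by rewrite -(lead_coef_map_inj val_inj (rmorph0 _)) defp; apply/eqP.
by apply/eqP/val_inj; rewrite lcq.
Qed.

Lemma integral_closure_additive : additive_set (integral_closure A).
Proof.
split=> [|x y /integral_closureP ix /integral_closureP iy]; apply/integral_closureP.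
  exact: integral0.
exact: integral_sub.
Qed.

Lemma sub_integral_closure : A `<=` integral_closure A.
Proof.
move=> x /mem_set Ax; apply/integral_closureP.
exact: (integral_id (val : {rmorphism subring_type ringA -> K}) (Sub x Ax)).
Qed.

(** Multiplying [x = p.[x^-1]] by [x ^+ (size p).-1] gives a monic equation
    for [x]. *)
Lemma integral_inverse (x : K) : x != 0 -> adjoin A x^-1 x ->
  integral_closure A x.
Proof.
move=> x0 [p Ap defx].
pose n := size p; pose r := \poly_(i < n) p`_(n.-1 - i).
have Ar i : A r`_i.
  by rewrite coef_poly; case: ifP => // _; apply: subring0.
exists ('X^n - r); split.
- rewrite monicE lead_coefDl ?lead_coefXn //.
  by rewrite size_polyN size_polyXn ltnS size_poly.
- apply/allP => _ /(nthP 0)[i _ <-]; apply/mem_set.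
  rewrite coefB coefXn; apply: subringB => //; case: eqP => _.
    exact: subring1.
  exact: subring0.
- rewrite /root hornerD hornerN hornerXn subr_eq0; apply/eqP.
  have [n0|n_gt0] := posnP n.
    move/eqP: n0; rewrite size_poly_eq0 => /eqP p0.
    by move: defx x0; rewrite p0 horner0 => ->; rewrite eqxx.
  have -> : x ^+ n = x ^+ n.-1 * p.[x^-1] by rewrite -defx -exprSr prednK.
  rewrite horner_coef -/n big_distrr /= horner_poly.
  have le_i (i : 'I_n) : (i <= n.-1)%N by rewrite -ltnS prednK.
  rewrite [RHS](reindex_inj rev_ord_inj) /=; apply: eq_bigr => i _.
  rewrite mulrCA; congr (p`__ * _); first by have := le_i i; lia.
  rewrite exprVn -expfB_cond ?(negbTE x0) ?le_i //.
  by congr (_ ^+ _); have := le_i i; lia.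
Qed.

End IntegralSum.

(** * Catenary rings *)

Section Catenary.
Variable A : comNzRingType.

Lemma prime_chain_insert n (C : nat -> set A) i Q :
  prime_chain setT n C -> (i < n)%N -> prime_ideal setT Q ->
  C i `<` Q -> Q `<` C i.+1 ->
  prime_chain setT n.+1
    (fun j => if (j <= i)%N then C j else if j == i.+1 then Q else C j.-1).
Proof.
move=> [Cprime Clt] lt_in primeQ ltCQ ltQC; split=> j le_j.
  case: leqP => [le_ji|lt_ij]; first by apply: Cprime; lia.
  by case: eqP => [//|ne]; apply: Cprime; lia.
rewrite /= ?eqSS; have [lt_ji|le_ij] := ltnP j i.
  by rewrite (ltnW lt_ji); apply: Clt; lia.
have [eq_ji|ne_ji] := eqVneq j i; first by rewrite eq_ji leqnn.
have lt_ij : (i < j)%N by lia.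
rewrite (leqNgt j) lt_ij /=.
have [->|ne_jSi] := eqVneq j i.+1; first by [].
by rewrite -[X in _ `<` C X]prednK ?(leq_ltn_trans _ lt_ij) //; apply: Clt; lia.
Qed.

(** A chain of maximal length between its ends is saturated. *)
Lemma catenary_length (P Q : set A) m n C D : catenary A ->
  saturated_chain setT m C -> C 0%N = P -> C m = Q ->
  prime_chain setT n D -> D 0%N = P -> D n = Q -> (n <= m)%N.
Proof.
move=> catA satC C0 Cm chD D0 Dn; have [[Cprime Clt] _] := satC.
have primeP : prime_ideal setT P by rewrite -C0; apply: Cprime.
have primeQ : prime_ideal setT Q by rewrite -Cm; apply: Cprime.
have sPQ : P `<=` Q.
  suff sCi i : (i <= m)%N -> P `<=` C i by rewrite -Cm; apply: sCi.
  elim: i => [|i IHi] le_i; first by rewrite C0.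
  by apply: subset_trans (IHi (ltnW le_i)) _; case: (Clt i le_i).
have [[N boundN] eq_len] := catA P Q primeP primeQ sPQ.
pose len k := `[< exists D, [/\ prime_chain setT k D, D 0%N = P & D k = Q] >].
have exlen : exists k, len k by exists n; apply/asboolP; exists D.
have lenN k : len k -> (k <= N)%N.
  by move=> /asboolP[E [chE E0 Ek]]; apply: boundN chE E0 Ek.
case: (ex_maxnP exlen lenN) => k /asboolP[E [chE E0 Ek]] maxk.
have satE : saturated_chain setT k E.
  split=> // i lt_ik [X [primeX ltEX ltXE]].
  have := maxk k.+1; rewrite ltnn => /(_ _)/negP; apply => //.
  apply/asboolP; eexists; split; first exact: prime_chain_insert ltEX ltXE.
    exact: E0.
  rewrite /= ltnNge (ltnW lt_ik) /= eqSS.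
  by case: eqP lt_ik => [->|//]; rewrite ltnn.
rewrite (eq_len _ _ _ _ satC C0 Cm satE E0 Ek).
by apply: maxk; apply/asboolP; exists D.
Qed.

End Catenary.

(** * Primes of polynomial rings *)

Lemma prime_preimage (B K : comNzRingType) (f : {rmorphism B -> K})
    (A P : set K) :
  range f = A -> prime_ideal A P -> prime_ideal [set: B] (f @^-1` P).
Proof.
move=> rangef [idP P1 PM]; have Af b : A (f b) by rewrite -rangef; exists b.
split; first split=> //=.
- by rewrite rmorph0; apply: ideal0 idP.
- by move=> x y Px Py; rewrite rmorphD; apply: (idealD idP).
- by move=> b x _ Px; rewrite rmorphM; apply: (ideal_mull idP).
- by rewrite /= rmorph1.
- by move=> x y _ _ /=; rewrite rmorphM; apply: PM.
Qed.

Lemma prime_image (B K : comNzRingType) (f : {rmorphism B -> K})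
    (A : set K) (Q : set B) : range f = A -> prime_ideal setT Q ->
  f @^-1` [set 0] `<=` Q ->
  prime_ideal A (f @` Q) /\ forall b, (f @` Q) (f b) -> Q b.
Proof.
move=> rangef [idQ Q1 QM] kerQ.
have ringT : is_subring [set: B] by apply/is_subringP; split.
have fQ b : (f @` Q) (f b) -> Q b.
  move=> [c Qc eq_fcb]; rewrite -(subrK c b); apply: (idealD idQ) => //.
  by apply: kerQ; rewrite /= rmorphB eq_fcb subrr.
split=> //; split; first split.
- by move=> _ [b _ <-]; rewrite -rangef; exists b.
- by exists 0; [apply: ideal0 idQ|rewrite rmorph0].
- move=> _ _ [b Qb <-] [c Qc <-]; rewrite -rmorphD.
  by exists (b + c) => //; apply: (idealD idQ).
- rewrite -rangef => _ _ [b _ <-] [c Qc <-]; rewrite -rmorphM.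
  by exists (b * c) => //; apply: (ideal_mull idQ).
- by rewrite -(rmorph1 f) => /fQ.
rewrite -rangef => _ _ [b _ <-] [c _ <-]; rewrite -rmorphM => /fQ.
by move=> /(QM _ _ I I)[Qb|Qc]; [left; exists b|right; exists c].
Qed.

(** The coefficient of [p * q] in degree [i + j], where [i] and [j] are the
    least degrees of coefficients outside [P], is [p`_i * q`_j] modulo [P]. *)
Lemma prime_polynomials (B : comNzRingType) (P : set B) :
  prime_ideal setT P -> prime_ideal setT [set p : {poly B} | forall i, P p`_i].
Proof.
move=> [idP P1 PM]; have ringT : is_subring [set: B] by apply/is_subringP; split.
split; first split=> //=.
- by move=> i; rewrite coef0; apply: ideal0 idP.
- by move=> p q Pp Pq i; rewrite coefD; apply: (idealD idP).
- move=> p q _ Pq i; rewrite coefM; apply: (ideal_sum idP) => j _.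
  exact: (ideal_mull idP).
- by move=> /(_ 0%N); rewrite coef1.
move=> p q _ _ Ppq; apply: contrapT => /not_orP[/existsNP np /existsNP nq].
have firstP (r : {poly B}) : (exists i, ~ P r`_i) ->
    exists2 i, ~ P r`_i & forall j, (j < i)%N -> P r`_j.
  move=> nr; have ex : exists i, `[< ~ P r`_i >].
    by case: nr => i /asboolP; exists i.
  case: (ex_minnP ex) => i /asboolP ni mini; exists i => // j lt_ji.
  by apply: contrapT => /asboolP/mini; rewrite leqNgt lt_ji.
have [i npi ltp] := firstP p np; have [j nqj ltq] := firstP q nq.
have : P (p`_i * q`_j); last by move=> /(PM _ _ I I)[].
have lt_i : (i < (i + j).+1)%N by rewrite ltnS leq_addr.
have := Ppq (i + j)%N; rewrite coefM (bigD1 (Ordinal lt_i)) //= addKn.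
set rest := \sum_(k < _ | _) _ => Psum; rewrite -[_ * _](addrK rest).
apply: (idealB ringT idP) => //; apply: (ideal_sum idP) => k ne_ki.
have {}ne_ki : (k : nat) != i by [].
have [lt_ki|le_ik] := ltnP k i; first by apply: (ideal_mulr idP) => //; apply: ltp.
by apply: (ideal_mull idP) => //; apply: ltq; have := ltn_ord k; lia.
Qed.

(** * Height one primes *)

Section HeightOne.
Variables (R : idomainType) (y : {fraction R}).

Definition eval_frac : {rmorphism {poly R} -> {fraction R}} :=
  horner_morph (fun x : R => mulrC y (tofrac x)).

Lemma eval_fracE p : eval_frac p = (map_poly (@tofrac R) p).[y].
Proof. by []. Qed.

Lemma base_subring : is_subring (base R).
Proof.
apply/is_subringP; split; first by exists 1; rewrite ?rmorph1.
  by move=> _ _ [a _ <-] [b _ <-]; exists (a - b); rewrite ?rmorphB.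
by move=> _ _ [a _ <-] [b _ <-]; exists (a * b); rewrite ?rmorphM.
Qed.

Lemma range_eval_frac : range eval_frac = adjoin (base R) y.
Proof.
apply/seteqP; split=> [_ [p _ <-]|_ [p Rp ->]].
  by exists (map_poly (@tofrac R) p) => // i; rewrite coef_map; exists p`_i.
have /choice[c cP] i : exists c, tofrac c = p`_i by have [c] := Rp i; exists c.
exists (\poly_(i < size p) c i) => //; rewrite eval_fracE; congr _.[_].
apply/polyP => i; rewrite coef_map coef_poly; case: ltnP => [_|le_i] /=.
  exact: cP.
by rewrite rmorph0 nth_default.
Qed.

Lemma adjoin_max_condition : noetherian R -> max_condition (adjoin (base R) y).
Proof.
move=> noethR; apply: (max_condition_image (adjoin_subring y base_subring)).
  exact: range_eval_frac.
by move=> I; apply: hilbert_basis.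
Qed.

Lemma prime0 (K : idomainType) (A : set K) : is_subring A ->
  prime_ideal A [set 0].
Proof.
move=> ringA; split; first split=> [_ ->|||].
- exact: subring0.
- by [].
- by move=> _ _ -> ->; rewrite /= addr0.
- by move=> a _ _ ->; rewrite /= mulr0.
- by move=> /eqP; rewrite oner_eq0.
- by move=> a b _ _ /eqP; rewrite mulf_eq0 => /orP[] /eqP; [left|right].
Qed.

(** A nonzero prime below the kernel of evaluation meets [R] trivially, so it
    corresponds to a nonzero prime of the principal ideal domain [Frac(R)['X]];
    pseudo-division by the linear polynomial vanishing at [y] replaces the
    passage to that ring. *)
Lemma no_prime_below_kernel (g f : R) (Q : set {poly R}) : f != 0 ->
  y = tofrac g / tofrac f -> prime_ideal setT Q -> [set 0] `<` Q ->
  ~ Q `<` eval_frac @^-1` [set 0].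
Proof.
move=> f0 defy [idQ Q1 QM] [_ nQ0] [sQK nKQ].
have ringT : is_subring [set: {poly R}] by apply/is_subringP; split.
pose N := f *: 'X - g%:P.
have sizeN : size N = 2%N.
  rewrite size_polyDl size_scale ?size_polyX // size_polyN.
  by rewrite (leq_ltn_trans (size_polyC_leq1 _)).
have KC c : eval_frac c%:P = 0 -> c = 0.
  rewrite eval_fracE map_polyC hornerC => /eqP.
  by rewrite tofrac_eq0 => /eqP.
have evN : eval_frac N = 0.
  rewrite eval_fracE rmorphB /= map_polyZ map_polyX map_polyC.
  rewrite hornerD hornerZ hornerX hornerN hornerC defy.
  by rewrite mulrC divfK ?subrr // tofrac_eq0.
have divN F : eval_frac F = 0 ->
    exists k D, (f ^+ k)%:P * F = D * N.
  move=> evF; pose k := scalp F N; pose D := F %/ N.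
  have := Pdiv.Idomain.divp_eq F N; rewrite -/k -/D.
  have -> : lead_coef N = f.
    by rewrite lead_coefE sizeN coefB coefZ coefX coefC /= mulr1 subr0.
  have lt_r : (size (F %% N)%R < 2)%N.
    by rewrite -sizeN ltn_modp -size_poly_eq0 sizeN.
  rewrite [F %% N]size1_polyC // => defF.
  have r0 : (F %% N)`_0 = 0.
    apply: KC; move/(congr1 eval_frac): defF.
    by rewrite -mul_polyC !rmorphM rmorphD rmorphM evF evN !mulr0 add0r => ->.
  by exists k, D; rewrite mul_polyC defF r0 addr0.
have nQN : ~ Q N.
  move=> QN; apply: nKQ => F evF; have [k [D defF]] := divN F evF.
  have : Q ((f ^+ k)%:P * F) by rewrite defF; apply: (ideal_mull idQ).
  case/(QM _ _ I I) => // /sQK/KC/eqP.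
  by rewrite expf_eq0 (negbTE f0) andbF.
apply: nQ0 => H QH; apply: contrapT => /eqP H0.
have [n le_n] := ubnP (size H); elim: n H QH H0 le_n => // n IHn H QH H0 le_n.
have [k [D defH]] := divN H (sQK _ QH).
have fk0 : (f ^+ k)%:P != 0 :> {poly R} by rewrite polyC_eq0 expf_neq0.
have D0 : D != 0.
  by apply: contraTneq (mulf_neq0 fk0 H0); rewrite defH => ->; rewrite mul0r eqxx.
have N0 : N != 0 by rewrite -size_poly_eq0 sizeN.
have : Q (D * N) by rewrite -defH; apply: (ideal_mull idQ).
case/(QM _ _ I I) => // QD; apply: (IHn D) => //.
have := congr1 (fun p : {poly R} => size p) defH.
rewrite /= mul_polyC size_scale ?expf_neq0 // size_mul // sizeN addn2 /= => eqs.
by rewrite -ltnS -eqs.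
Qed.

(** The chain [0], kernel of evaluation at [y], preimage of [q] is saturated of
    length 2 because [q] has height one. A prime strictly between [0] and the
    contraction of [q] to [R] would give a chain of length 3 with the same
    ends, since ['X] belongs to the preimage of [q] but to no prime extended
    from [R]. *)
Lemma height_contraction (g f : R) (q : set {fraction R}) :
  universally_catenary R -> f != 0 -> y = tofrac g / tofrac f -> y != 0 ->
  prime_ideal (adjoin (base R) y) q -> q y ->
  (forall p, prime_ideal (adjoin (base R) y) p -> p `<=` q -> p <> q ->
     p = [set 0]) ->
  height_is (base R) (q `&` base R) 1.
Proof.
move=> ucatR f0 defy y0 primeq qy ht_q.
have ringR := base_subring.
have ringT : is_subring (adjoin (base R) y) by apply: adjoin_subring.
have sRT : base R `<=` adjoin (base R) y by apply: sub_adjoin; apply: subring0.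
have idq := prime_ideal_ideal primeq.
have primep : prime_ideal (base R) (q `&` base R) by apply: prime_contraction sRT.
have lt0p : [set 0] `<` q `&` base R.
  split=> [_ ->|s0]; first by split; [apply: ideal0 idq|apply: subring0].
  have : [set 0] (tofrac g).
    apply: s0; split; last by exists g.
    have -> : tofrac g = tofrac f * y.
      by rewrite defy mulrCA divff ?mulr1 // tofrac_eq0.
    by apply: (ideal_mull idq) => //; apply: sRT; exists f.
  move=> /eqP g0; move: y0; rewrite defy.
  by rewrite (eqP g0) mul0r eqxx.
suff no_between p1 : prime_ideal (base R) p1 -> [set 0] `<` p1 ->
    ~ p1 `<` q `&` base R.
  split.
    exists (fun i => if i is 0%N then [set 0] else q `&` base R) => //.
    split=> [[|i] _ //|[|i] //]; exact: prime0.
  move=> [|[|m]] C [Cprime Clt] Cm //; case: (no_between (C m.+1)).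
  - exact: Cprime.
  - split=> [_ ->|s0]; first by have [/ideal0] := Cprime m.+1 (leqnSn _).
    have [sC nsC] := Clt m (leqnSn _); apply: nsC => z /s0 ->.
    by have [/ideal0] := Cprime m (leqW (leqnSn m)).
  - by rewrite -Cm; apply: Clt.
move=> primep1 lt0p1 ltp1p.
have rangeR : range (@tofrac R) = base R by [].
pose ext (p : set {fraction R}) := [set F : {poly R} | forall i, p (tofrac F`_i)].
have prime_ext p : prime_ideal (base R) p -> prime_ideal setT (ext p).
  by move=> /(prime_preimage rangeR)/prime_polynomials.
have prime_ev p : prime_ideal (adjoin (base R) y) p ->
    prime_ideal setT (eval_frac @^-1` p).
  exact: prime_preimage range_eval_frac.
have ev0 : eval_frac 'X = y by rewrite eval_fracE map_polyX hornerX.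
have evC c : eval_frac c%:P = tofrac c by rewrite eval_fracE map_polyC hornerC.
have extC p c : p 0 -> ext p c%:P <-> p (tofrac c).
  move=> p0; split=> [/(_ 0%N)|pc i]; first by rewrite coefC.
  by rewrite coefC; case: ifP => // _; rewrite rmorph0.
pose C i := match i with
  | 0%N => [set 0] | 1%N => eval_frac @^-1` [set 0] | _ => eval_frac @^-1` q end.
have ringP : is_subring [set: {poly R}] by apply/is_subringP; split.
have satC : saturated_chain setT 2 C.
  split; first split.
  - move=> [|[|[|i]]] // _; first exact: prime0.
      by apply: prime_ev; apply: prime0.
    exact: prime_ev.
  - move=> [|[|i]] // _; split.
    + by move=> _ ->; rewrite /= rmorph0.
    + move=> /(_ (f *: 'X - g%:P)) /=.
      rewrite rmorphB /= -mul_polyC rmorphM evC ev0 evC defy mulrCA.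
      rewrite divff ?tofrac_eq0 //.
      rewrite mulr1 subrr => /(_ erefl)/(congr1 (fun F : {poly R} => F`_1)).
      rewrite coefB coefCM coefX coefC coef0 /= mulr1 subr0 => /eqP.
      by rewrite (negbTE f0).
    + by move=> F /= ->; apply: ideal0 idq.
    + move=> /(_ 'X) /=; rewrite ev0 => /(_ qy)/eqP.
      by rewrite (negbTE y0).
  move=> [|[|i]] // _ [Q [primeQ lt1 lt2]].
    exact: (no_prime_below_kernel f0 defy primeQ lt1 lt2).
  have [primefQ fQ] := prime_image range_eval_frac primeQ (properW lt1).
  have fQ0 : eval_frac @` Q = [set 0].
    apply: ht_q => //.
      by move=> _ [F QF <-]; apply: (properW lt2).
    move=> eqfQ; case: lt2 => _; apply=> F /= qF; apply: fQ.
    by rewrite eqfQ.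
  case: lt1 => _; apply=> F QF; suff : (eval_frac @` Q) (eval_frac F) by rewrite fQ0.
  by exists F.
pose D i := match i with
  | 0%N => [set 0] | 1%N => ext p1 | 2%N => ext (q `&` base R)
  | _ => eval_frac @^-1` q end.
have chD : prime_chain setT 3 D.
  have [idp idp1] := (prime_ideal_ideal primep, prime_ideal_ideal primep1).
  split; first move=> [|[|[|[|i]]]] // _.
  - exact: prime0.
  - exact: prime_ext.
  - exact: prime_ext.
  - exact: prime_ev.
  move=> [|[|[|i]]] // _; split.
  - by move=> _ -> i; rewrite coef0 rmorph0; apply: ideal0 idp1.
  - move=> s0; case: lt0p1 => _; apply=> z p1z.
    have [c _ defz] := ideal_sub idp1 p1z.
    have : [set 0] c%:P.
      by apply: s0; apply/extC; [apply: ideal0 idp1|rewrite defz].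
    by move=> /eqP; rewrite polyC_eq0 -defz => /eqP->; rewrite rmorph0.
  - by move=> F p1F i; apply: (properW ltp1p).
  - move=> sp; case: ltp1p => _; apply=> z pz; have [_ [c _ defz]] := pz.
    rewrite -defz; apply/extC; first exact: ideal0 idp1.
    by apply: sp; apply/extC; [apply: ideal0 idp|rewrite defz].
  - move=> F pF; rewrite /= eval_fracE horner_coef; apply: (ideal_sum idq) => i _.
    rewrite coef_map; apply: (ideal_mulr idq); last by case: (pF i).
    by apply: subringX => //; apply: mem_adjoin; [apply: subring0|apply: subring1].
  - move=> sp; have /sp/(_ 1%N) : (eval_frac @^-1` q) 'X by rewrite /= ev0.
    by rewrite coefX rmorph1 => -[q1 _]; case: primeq => _ /(_ q1).
have catP : catenary {poly R}.
  apply: (ucatR _ (@polyC R : {rmorphism R -> {poly R}})).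
  exists [:: 'X]; apply/seteqP; split=> // F _ S [ringS sS].
  have SC c : S c%:P by apply: sS; left; exists c.
  have SX : S 'X by apply: sS; right; rewrite /= inE eqxx.
  elim/poly_ind: F => [|F c SF]; first by rewrite -polyC0.
  by apply: subringD => //; apply: subringM.
by have := catenary_length catP satC erefl erefl chD erefl erefl.
Qed.

End HeightOne.

(** * Localization inside a field *)

Section Localization.
Variables (K : fieldType) (A W : set K).
Hypotheses (ringA : is_subring A) (multW : mult_subset A W).

Let sWA : W `<=` A. Proof. by case: multW. Qed.
Let W1 : W 1. Proof. by case: multW => _ _ [W1 _]; apply: set_mem. Qed.
Let WM u v : W u -> W v -> W (u * v).
Proof.
by case: multW => _ _ [_ WM] /mem_set Wu /mem_set Wv; apply/set_mem/WM.
Qed.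
Let W0 w : W w -> w != 0.
Proof. by case: multW => _ W0 _ Ww; apply/eqP => w0; apply: W0; rewrite -w0. Qed.

Lemma loc_additive X : additive_set X ->
  (forall x w, X x -> W w -> X (x * w)) -> additive_set (loc X W).
Proof.
move=> [X0 XB] XW; split; first by exists 0 => //; exists 1; rewrite ?mul0r.
move=> _ _ [x Xx] [v Wv] <- [y Xy] [w Ww] <-.
exists (x * w - y * v); first by apply: XB; apply: XW.
exists (v * w); first exact: WM.
by rewrite -[- (y / w)]mulNr addf_div ?W0 // mulNr.
Qed.

Lemma sub_loc X : X `<=` loc X W.
Proof. by move=> x Xx; exists x => //; exists 1; rewrite ?divr1. Qed.

Lemma loc_inv w : W w -> loc A W w^-1.
Proof.
by move=> Ww; exists 1; [apply: subring1|exists w; rewrite ?mul1r].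
Qed.

Lemma loc_subring : is_subring (loc A W).
Proof.
apply/is_subringP; split; first by apply: sub_loc; apply: subring1.
  apply: (proj2 (loc_additive (subring_additive ringA) _)) => x w Ax /sWA.
  exact: subringM.
move=> _ _ [x Ax] [v Wv] <- [y Ay] [w Ww] <-.
exists (x * y); first exact: subringM.
by exists (v * w); [apply: WM|rewrite mulf_div].
Qed.

Lemma loc_min S : is_subring S -> A `<=` S -> (forall w, W w -> S w^-1) ->
  loc A W `<=` S.
Proof.
move=> ringS sAS SV _ [x Ax] [w Ww] <-.
by apply: subringM => //; [apply: sAS|apply: SV].
Qed.

(** A fraction and its numerator lie in the same ideals, the denominator being
    invertible. *)
Lemma loc_ideal_sub S S' I J : ideal S I -> ideal S' J -> is_subring S' ->
  A `<=` S -> loc A W `<=` S' -> I `&` A `<=` J -> I `&` loc A W `<=` J.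
Proof.
move=> idI idJ ringS' sAS sAWS' sIJ z [Iz [x Ax [w Ww defz]]].
move: Iz; rewrite -defz => Ixw; apply: (ideal_mulr idJ).
  by apply: sAWS'; apply: loc_inv.
apply: sIJ; split=> //; rewrite -(divfK (W0 Ww) x).
by apply: (ideal_mulr idI) => //; apply/sAS/sWA.
Qed.

Lemma loc_prime P : prime_ideal A P -> (forall w, W w -> ~ P w) ->
  prime_ideal (loc A W) (loc P W) /\ loc P W `&` A = P.
Proof.
move=> [idP P1 PM] nPW.
have addPW : additive_set (loc P W).
  apply: loc_additive (ideal_additive ringA idP) _ => x w Px Ww.
  by apply: (ideal_mulr idP) => //; apply: sWA.
have capP z : A z -> loc P W z -> P z.
  move=> Az [x Px] [w Ww] defz; have : P (z * w) by rewrite -defz divfK ?W0.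
  by move=> /(PM _ _ Az (sWA Ww))[//|/(nPW _ Ww)].
split; last first.
  apply/seteqP; split=> [z [/capP Pz /Pz //]|z Pz].
  by split; [apply: sub_loc|apply: ideal_sub Pz].
split; first split.
- move=> _ [x Px] [w Ww] <-; exists x; first exact: ideal_sub Px.
  by exists w.
- by case: addPW.
- by move=> x y; apply: (additiveD addPW).
- move=> _ _ [x Ax] [v Wv] <- [y Py] [w Ww] <-.
  exists (x * y); first exact: (ideal_mull idP).
  by exists (v * w); [apply: WM|rewrite mulf_div].
- by move/(capP _ (subring1 ringA)).
move=> _ _ [x Ax] [v Wv] <- [y Ay] [w Ww] <- [z Pz] [t Wt] defz.
have : P (x * y * t).
  have -> : x * y * t = v * w * z.
    have -> : z = x / v * (y / w) * t by rewrite -defz divfK ?W0.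
    by rewrite mulf_div mulrA [v * w * _]mulrC divfK // mulf_neq0 ?W0.
  by apply: (ideal_mull idP) => //; apply: (subringM ringA); apply: sWA.
move=> /(PM _ _ (subringM ringA Ax Ay) (sWA Wt))[|/(nPW _ Wt)//].
by move=> /(PM _ _ Ax Ay)[Px|Py]; [left; exists x|right; exists y] => //;
  [exists v|exists w].
Qed.

End Localization.

(** * The grading of the quotient field *)

Section FractionGrading.
Variables (R : idomainType) (G : int -> set R).
Hypothesis gradedR : grading G.

Lemma grading_additive a : additive_set (G a).
Proof.
have [G0 _ _ _] := gradedR; have [z0 zB] := G0 a; split; first exact: set_mem.
by move=> x y /mem_set Gx /mem_set Gy; apply/set_mem/zB.
Qed.

Lemma gradingM a b x y : G a x -> G b y -> G (a + b) (x * y).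
Proof. by case: gradedR => _ GM _ _; apply: GM. Qed.

Lemma nonzero_homogeneous : exists a x, G a x /\ x != 0.
Proof.
have [_ _ gradT _] := gradedR; have [s [f [Gf def1]]] := gradT 1 I.
apply: contrapT => no; have /eqP[] := oner_neq0 R.
rewrite def1 big1 // => a _; apply: contrapT => /eqP fa0; apply: no.
by exists a, (f a); case: (Gf a).
Qed.

(** Clearing denominators shifts all degrees by the same amount, so linear
    independence of components reduces to that in [R]. *)
Lemma common_denominator (s : seq int) (z : int -> {fraction R}) :
  (forall a, frac_deg G a (z a)) ->
  exists (d : int) (w : R) (u : int -> R), [/\ G d w, w != 0 &
    forall a, a \in s -> G (a + d) (u a) /\ z a * tofrac w = tofrac (u a)].
Proof.
move=> degz; elim: s => [|b s [d [w [u [Gw w0 uP]]]]].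
  by have [d [w [Gw w0]]] := nonzero_homogeneous; exists d, w, (fun=> 0).
have [e [c [f [g [Gf Gg g0 defb zb]]]]] := degz b.
exists (d + c), (w * g), (fun a => if a == b then f * w else u a * g).
split; [exact: gradingM|exact: mulf_neq0|].
move=> a; rewrite inE; have [-> _|_ /= /uP[Gu zu]] := eqVneq a b.
  have eqd : b + (d + c) = e + d by rewrite defb; lia.
  split; first by rewrite eqd; apply: gradingM.
  by rewrite zb !rmorphM /= [X in _ * X]mulrC mulrA divfK ?tofrac_eq0 //.
split; first by rewrite addrA; apply: gradingM.
by rewrite !rmorphM /= mulrA zu.
Qed.

Lemma frac_deg_pieces : graded_pieces (frac_deg G).
Proof.
split.
- move=> a; have [d [w [Gw w0]]] := nonzero_homogeneous; split.
    exists (a + d), d, 0, w; rewrite addrK rmorph0 mul0r; split=> //.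
    by case: (grading_additive (a + d)).
  move=> _ _ [b [c [f [g [Gf Gg g0 defa ->]]]]]
             [b' [c' [f' [g' [Gf' Gg' g'0 defa' ->]]]]].
  exists (b + c'), (c + c'), (f * g' - f' * g), (g * g'); split.
  + apply: (proj2 (grading_additive _)); first exact: gradingM.
    rewrite (_ : b + c' = b' + c); first exact: gradingM.
    by move: defa'; rewrite defa; lia.
  + exact: gradingM.
  + exact: mulf_neq0.
  + by rewrite defa; lia.
  + rewrite -mulNr addf_div ?tofrac_eq0 //.
    by rewrite !(rmorphM, rmorphB) /= mulNr.
- have [d [w [Gw w0]]] := nonzero_homogeneous.
  by exists d, d, w, w; rewrite subrr divff // tofrac_eq0.
- move=> a a' _ _ [b [c [f [g [Gf Gg g0 -> ->]]]]]
                  [b' [c' [f' [g' [Gf' Gg' g'0 -> ->]]]]].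
  exists (b + b'), (c + c'), (f * f'), (g * g'); split.
  + exact: gradingM.
  + exact: gradingM.
  + exact: mulf_neq0.
  + by lia.
  + by rewrite mulf_div !rmorphM.
move=> s z us degz sumz a sa.
have [d [w [u [Gw w0 uP]]]] := common_denominator s degz.
have [_ _ _ Gind] := gradedR.
pose v e := if e - d \in s then u (e - d) else 0.
have Gv e : G e (v e).
  rewrite /v; case: ifP => [/uP[Gu _]|_]; first by rewrite subrK in Gu.
  by case: (grading_additive e).
have vD b : b \in s -> v (b + d) = u b by rewrite /v addrK => ->.
have sumv : \sum_(e <- [seq b + d | b <- s]) v e = 0.
  apply/eqP; rewrite -tofrac_eq0 rmorph_sum big_map /=; apply/eqP.
  transitivity (\sum_(b <- s) z b * tofrac w); last first.
    by rewrite -big_distrl /= sumz mul0r.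
  by apply: eq_big_seq => b sb; rewrite vD //; case: (uP b sb).
have v0 := Gind _ v _ Gv sumv (a + d).
have /eqP : z a * tofrac w = 0.
  by case: (uP a sa) => _ ->; rewrite -vD // v0 ?rmorph0 //;
    [rewrite map_inj_uniq //; apply: addIr|apply: map_f].
by rewrite mulf_eq0 tofrac_eq0 (negbTE w0) orbF => /eqP.
Qed.

Let gradF := frac_deg_pieces.

Lemma frac_deg_base a x : G a x -> frac_deg G a (tofrac x).
Proof.
move=> Gx; have [d [w [Gw w0]]] := nonzero_homogeneous.
exists (a + d), d, (x * w), w; rewrite addrK rmorphM mulfK ?tofrac_eq0 //.
by split=> //; apply: gradingM.
Qed.

Lemma frac_degV a z : frac_deg G a z -> z != 0 -> frac_deg G (- a) z^-1.
Proof.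
move=> [b [c [f [g [Gf Gg g0 -> ->]]]]] fg0; exists c, b, g, f; split=> //.
- by apply: contra_neq fg0 => ->; rewrite rmorph0 mul0r.
- by rewrite opprB.
- by rewrite invf_div.
Qed.

Lemma base_graded : graded (frac_deg G) (base R).
Proof.
move=> _ [x _ <-]; have [_ _ gradT _] := gradedR.
have [s [f [Gf ->]]] := gradT x I; exists s, (fun a => tofrac (f a)).
split=> [a|]; last exact: rmorph_sum.
by split; [apply: frac_deg_base; case: (Gf a)|exists (f a)].
Qed.

(** ** Homogeneous localizations *)

Lemma gr_quotient_homogeneous S z : base R `<=` S -> homogeneous G z ->
  gr_quotient G S z.
Proof.
move=> sRS [a [b [c [f [g [Gf Gg g0 _ ->]]]]]].
exists (tofrac f); first by apply: sRS; exists f.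
exists (tofrac g) => //; split; first by apply: sRS; exists g.
  by exists c; apply: frac_deg_base.
by apply/eqP; rewrite tofrac_eq0.
Qed.

(** Dividing the components of a numerator by a homogeneous denominator shifts
    their degrees. *)
Lemma loc_graded (A W X : set {fraction R}) : mult_subset A W ->
  (forall w, W w -> homogeneous G w) ->
  additive_set (loc X W) -> graded (frac_deg G) X ->
  graded (frac_deg G) (loc X W).
Proof.
move=> [_ W0 _] homW addXW gradX _ [x Xx] [w Ww] <-.
have [s [f [Gf ->]]] := gradX x Xx; have [b degw] := homW w Ww.
rewrite big_distrl /=.
apply: (@graded_coreP _ _ gradF _ _ s (fun a => a - b) (fun a => f a / w) addXW).
move=> a; have [Ga Xa] := Gf a; have [_ _ GM _] := gradF.
have w0 : w != 0 by apply/eqP => w0; apply: W0; rewrite -w0.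
split; first by apply: GM => //; apply: frac_degV.
by exists (f a) => //; exists w.
Qed.

Definition homogeneous_complement (P : set {fraction R}) : set {fraction R} :=
  [set x | [/\ base R x, homogeneous G x & ~ P x]].

Lemma homogeneous_complement_mult P : prime_ideal (base R) P ->
  mult_subset (base R) (homogeneous_complement P).
Proof.
move=> primeP; have [idP P1 PM] := primeP; split.
- by move=> x [].
- by case=> _ _; apply; apply: ideal0 idP.
have [_ G1 GM _] := gradF.
split.
  by apply/mem_set; split=> //; [apply: subring1 (base_subring R)|exists 0].
move=> x y /set_mem[Rx [a Gx] Px] /set_mem[Ry [b Gy] Py]; apply/mem_set; split.
- exact: (subringM (base_subring R)).
- by exists (a + b); apply: GM.
- exact: (primeNM primeP).
Qed.

End FractionGrading.

(** * Graded maximal ideals *)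

Section GradedMaximal.
Variables (R : idomainType) (G : int -> set R).
Hypothesis gradedR : grading G.
Let gradF := frac_deg_pieces gradedR.
Let ringR := base_subring R.
Let gradR := base_graded gradedR.

Section GradedRing.
Variable S : set {fraction R}.
Hypotheses (ringS : is_subring S) (gradS : graded (frac_deg G) S).

Lemma graded_proper_ideal1 I : graded_proper_ideal G S I -> ~ I 1.
Proof. by case=> idI _ + I1; apply; apply: ideal1 idI I1. Qed.

Lemma graded_proper_idealP I : ideal S I -> graded (frac_deg G) I -> ~ I 1 ->
  graded_proper_ideal G S I.
Proof.
by move=> idI gradI I1; split=> // eqIS; apply: I1; rewrite eqIS; apply: subring1.
Qed.

Lemma gr_maximal_above I : graded_proper_ideal G S I ->
  exists2 M, gr_maximal G S M & I `<=` M.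
Proof.
move=> propI; have [C C0 Ctot CF|M [propM sIM Mmax]] := zorn_above propI.
  have CI : C `<=` ideal S by move=> X /CF[].
  apply: graded_proper_idealP; first exact: ideal_chain.
  - move=> x [X CX Xx]; have [_ gradX _] := CF X CX.
    have [s [f [Gf defx]]] := gradX x Xx; exists s, f; split=> // a.
    by case: (Gf a) => Ga Xa; split=> //; exists X.
  - by move=> [X CX]; apply: graded_proper_ideal1 (CF X CX).
by exists M => //; split.
Qed.

Lemma principal_graded a x : frac_deg G a x -> S x ->
  graded (frac_deg G) [set x * c | c in S].
Proof.
move=> Gx Sx _ [c Sc <-]; have [s [f [Gf ->]]] := gradS Sc.
have addxS := ideal_additive ringS (ideal_principal ringS Sx).
rewrite big_distrr /=.
apply: (@graded_coreP _ _ gradF _ _ s (fun d => a + d) (fun d => x * f d) addxS).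
move=> d; have [Gd Sd] := Gf d; have [_ _ GM _] := gradF.
by split; [apply: GM|exists (f d)].
Qed.

(** If [x] is homogeneous outside [M], the graded ideal [M + (x)] contains [1],
    and multiplying by [y] puts [y] in [M] as soon as [x * y] is there. *)
Lemma gr_maximal_prime M : gr_maximal G S M -> hSpec G S M.
Proof.
move=> [propM Mmax]; have [idM gradM _] := propM; split=> //.
have M1 := graded_proper_ideal1 propM.
apply: (graded_prime gradF) => // a b x y Gx Gy Sx Sy Mxy.
apply: contrapT => /not_orP[nMx nMy]; apply: nMx.
have [addS addM] := (subring_additive ringS, ideal_additive ringS idM).
have gradx := principal_graded Gx Sx.
have idMx : ideal S (add_principal S M x) by apply: ideal_add_principal.
rewrite -(Mmax (add_principal S M x)); first exact: mem_add_principal.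
  apply: graded_proper_idealP => //.
    apply: graded_add => //.
    exact: ideal_additive ringS (ideal_principal ringS Sx).
  move=> [m Mm [_ [c Sc <-] def1]]; apply: nMy.
  rewrite -(mul1r y) -def1 mulrDl mulrAC.
  by apply: (idealD idM); apply: (ideal_mulr idM).
exact: sub_add_principal.
Qed.

Lemma gr_local_sub M I : gr_local G S -> gr_maximal G S M ->
  graded_proper_ideal G S I -> I `<=` M.
Proof.
move=> [M0 [_ uniqM0]] maxM /gr_maximal_above[N maxN sIN].
by rewrite -(uniqM0 M maxM) (uniqM0 N maxN).
Qed.

Lemma hSpec_proper Q : hSpec G S Q -> graded_proper_ideal G S Q.
Proof. by case=> -[idQ Q1 _] gradQ; apply: graded_proper_idealP. Qed.

(** Otherwise [w] would generate a proper graded ideal, contained in [M]. *)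
Lemma gr_local_unit M w : gr_local G S -> gr_maximal G S M -> S w ->
  homogeneous G w -> ~ M w -> S w^-1.
Proof.
move=> locS maxM Sw [a Gw] nMw.
have idM : ideal S M by case: maxM => -[].
have w0 : w != 0 by apply/eqP => w0; apply: nMw; rewrite w0; apply: ideal0 idM.
have idw := ideal_principal ringS Sw.
have [[c Sc wc1]|w1] := pselect ([set w * c | c in S] 1).
  by rewrite -[w^-1]mulr1 -wc1 mulKf.
case: nMw; apply: (gr_local_sub locS maxM (I := [set w * c | c in S])).
  by apply: graded_proper_idealP => //; apply: principal_graded Gw Sw.
by exists 1; [apply: subring1|rewrite mulr1].
Qed.

Lemma hSpec_contraction A Q : is_subring A -> graded (frac_deg G) A ->
  A `<=` S -> hSpec G S Q -> hSpec G A (Q `&` A).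
Proof.
move=> ringA gradA sAS [primeQ gradQ]; split; first exact: prime_contraction sAS.
have idQ := prime_ideal_ideal primeQ.
apply: (graded_cap gradF) => //; first exact: ideal_additive idQ.
exact: subring_additive.
Qed.

End GradedRing.

(** * Homogeneous localizations of the base ring *)

Section BaseLocalization.
Variable P : set {fraction R}.
Hypothesis specP : hSpec G (base R) P.

Local Notation A := (gr_loc G (base R) P).

Let primeP : prime_ideal (base R) P. Proof. by case: specP. Qed.
Let multW : mult_subset (base R) (homogeneous_complement G P).
Proof. exact: homogeneous_complement_mult. Qed.

Lemma gr_loc_subring : is_subring A.
Proof. exact: loc_subring ringR multW. Qed.

Lemma sub_gr_loc : base R `<=` A.
Proof. exact: sub_loc multW _. Qed.

Lemma gr_loc_graded : graded (frac_deg G) A.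
Proof.
apply: (loc_graded gradedR multW) => //; first by move=> w [].
exact: subring_additive gr_loc_subring.
Qed.

Lemma gr_loc_inv w : base R w -> homogeneous G w -> ~ P w -> A w^-1.
Proof. by move=> Rw hw nPw; exact: (loc_inv ringR (And3 Rw hw nPw)). Qed.

Lemma gr_loc_min S : is_subring S -> base R `<=` S ->
  (forall w, base R w -> homogeneous G w -> ~ P w -> S w^-1) -> A `<=` S.
Proof.
move=> ringS sRS SV; apply: loc_min => // w [Rw hw nPw].
exact: SV.
Qed.

Lemma gr_loc_ideal_sub S S' I J : ideal S I -> ideal S' J -> is_subring S' ->
  base R `<=` S -> A `<=` S' -> I `&` base R `<=` J -> I `&` A `<=` J.
Proof. exact: (loc_ideal_sub ringR multW). Qed.

(** A homogeneous element of [R] outside [P] is invertible in [S]. *)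
Lemma contraction_sub_center S I : is_subring S -> A `<=` S -> ideal S I ->
  graded (frac_deg G) I -> ~ I 1 -> I `&` base R `<=` P.
Proof.
move=> ringS sAS idI gradI I1; have idP := prime_ideal_ideal primeP.
have [addI addR] := (ideal_additive ringS idI, subring_additive ringR).
apply: (graded_sub (graded_cap gradF addI addR gradI gradR)).
  exact: ideal_additive idP.
move=> a x Gx [Ix Rx]; apply: contrapT => nPx; apply: I1.
have x0 : x != 0 by apply/eqP => x0; apply: nPx; rewrite x0; apply: ideal0 idP.
rewrite -(mulVf x0); apply: (ideal_mull idI) => //; apply: sAS.
by apply: gr_loc_inv => //; exists a.
Qed.

Lemma extended_hSpec Q : hSpec G (base R) Q -> Q `<=` P ->
  exists2 Q', hSpec G A Q' & Q' `&` base R = Q.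
Proof.
move=> [primeQ gradQ] sQP.
have [|primeQ' capQ'] := loc_prime ringR multW primeQ.
  by move=> w [_ _ nPw] /sQP.
exists (loc Q (homogeneous_complement G P)) => //; split=> //.
apply: (loc_graded gradedR multW) => //; first by move=> w [].
exact: ideal_additive gr_loc_subring (prime_ideal_ideal primeQ').
Qed.

End BaseLocalization.

(** If [x] is homogeneous and [x * w] lies in the base ring, so do the products
    of [x] with all components of [w]. When [w] is invertible in [S], one of
    these components is outside [I] and serves as a homogeneous denominator. *)
Lemma graded_localization_sub S W I : is_subring S -> graded (frac_deg G) S ->
  base R `<=` S -> mult_subset (base R) W -> S = loc (base R) W ->
  hSpec G S I -> S `<=` gr_loc G (base R) (I `&` base R).
Proof.
move=> ringS gradS sRS multW defS specI.
have specP := hSpec_contraction ringS ringR gradR sRS specI.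
have [[idI I1 _] gradI] := specI.
apply: (graded_sub gradS); first exact: subring_additive (gr_loc_subring specP).
move=> a x Gx; rewrite {1}defS => -[r Rr [w Ww defx]].
have [sWR W0 _] := multW.
have w0 : w != 0 by apply/eqP => w0; apply: W0; rewrite -w0.
have SwV : S w^-1 by rewrite defS; apply: (loc_inv ringR).
have [addR [_ _ GM _]] := (subring_additive ringR, gradF).
have [s [f [us Gf defw]]] := graded_uniq gradF addR gradR (sWR w Ww).
have [b [sb nIb]] : exists b, b \in s /\ ~ I (f b).
  apply: contrapT => no; apply: I1; rewrite -(mulfV w0).
  apply: (ideal_mulr idI) => //; rewrite defw big_seq.
  apply: (ideal_sum idI) => b sb; apply: contrapT => nIb.
  by apply: no; exists b.
have Rxb : base R (x * f b).
  have := @graded_component _ _ gradF (base R) _ s (fun b => a + b)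
    (fun b => x * f b) (a + b) addR gradR.
  have -> : \sum_(i <- s) x * f i = r by rewrite -big_distrr /= -defw -defx divfK.
  have -> : \sum_(i <- s | a + i == a + b) x * f i = x * f b.
    under eq_bigl do rewrite (inj_eq (addrI a)).
    by rewrite -big_filter filter_pred1_uniq // big_seq1.
  apply=> // c; apply: GM => //; by case: (Gf c).
have fb0 : f b != 0 by apply/eqP => fb0; apply: nIb; rewrite fb0; apply: ideal0 idI.
exists (x * f b) => //; exists (f b); last by rewrite mulfK.
have [Gb Rb] := Gf b; split=> //; first by exists b.
by case.
Qed.

End GradedMaximal.

(** * Graded valuation overrings *)

(** Of the two equations [p.[x] = 1] and [q.[x^-1] = 1], the one of larger
    degree has its leading term eliminated with the help of the other. *)
Lemma adjoin_exchange (K : fieldType) (V I : set K) (x : K) : is_subring V ->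
  ideal V I -> x != 0 -> adjoin I x 1 -> adjoin I x^-1 1 -> I 1.
Proof.
move=> ringV idI x0 [p Ip p1] [q Iq q1].
have [n le_n] := ubnP (size p + size q)%N.
elim: n x x0 p Ip p1 q Iq q1 le_n => // n IHn x x0 p Ip p1 q Iq q1 le_n.
wlog le_qp : x x0 p Ip p1 q Iq q1 le_n / (size q <= size p)%N => [IHpq|].
  have [le_qp|/ltnW le_pq] := leqP (size q) (size p).
    exact: (IHpq x x0 p Ip p1 q).
  by apply: (IHpq x^-1 _ q Iq _ p Ip); rewrite ?invr_eq0 ?invrK // addnC.
have [le_p1|lt_1p] := leqP (size p) 1.
  by rewrite p1 (size1_polyC le_p1) hornerC.
pose m := (size p).-1; have sizep : size p = m.+1 by rewrite prednK // ltnW.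
have m_gt0 : (0 < m)%N by rewrite -ltnS -sizep.
pose a := p`_m; pose r := \poly_(i < m) q`_(m - i).
have rx : r.[x] = x ^+ m * (1 - q`_0).
  have -> : x ^+ m * (1 - q`_0) = x ^+ m * q.[x^-1] - q`_0 * x ^+ m.
    by rewrite -q1 mulrBr mulr1 [x ^+ m * q`_0]mulrC.
  have -> : x ^+ m * q.[x^-1] = \sum_(i < m.+1) q`_(m - i) * x ^+ i.
    rewrite (@horner_coef_wide _ m.+1) -?sizep // big_distrr /= sizep.
    rewrite [RHS](reindex_inj rev_ord_inj) /=; apply: eq_bigr => i _.
    have le_i : (i <= m)%N by rewrite -ltnS.
    rewrite subSS subKn // mulrCA; congr (_ * _).
    by rewrite exprVn -expfB_cond // (negbTE x0).
  by rewrite big_ord_recr /= subnn addrK horner_poly.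
have px : (\poly_(i < m) p`_i).[x] = 1 - a * x ^+ m.
  by rewrite horner_poly p1 horner_coef sizep big_ord_recr /= addrK.
pose p' := (1 - q`_0) *: \poly_(i < m) p`_i + (q`_0)%:P + a *: r.
have sizep' : (size p' <= m)%N.
  apply/leq_sizeP => j le_mj; rewrite !coefD !coefZ !coef_poly coefC ltnNge le_mj.
  by rewrite gtn_eqF ?(leq_trans m_gt0) //= !mulr0 !addr0.
have IV := ideal_sub idI.
apply: (IHn x x0 p' _ _ q Iq q1).
- move=> i; rewrite !coefD !coefZ !coef_poly coefC; apply: (idealD idI).
    apply: (idealD idI); last by case: eqP => // _; apply: ideal0 idI.
    case: ltnP => _; last by rewrite mulr0; apply: ideal0 idI.
    apply: (ideal_mull idI) => //; apply: subringB => //; first exact: subring1.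
    exact: IV.
  case: ltnP => _; last by rewrite mulr0; apply: ideal0 idI.
  exact: (ideal_mull idI (IV _ (Ip m)) (Iq _)).
- rewrite !hornerD !hornerZ hornerC rx px.
  by ring.
- by move: le_n; rewrite sizep ltnS; apply: leq_trans; rewrite addSn ltnS leq_add2r.
Qed.

Section Perinormal.
Variables (R : idomainType) (G : int -> set R).
Hypothesis gradedR : grading G.
Let gradF := frac_deg_pieces gradedR.
Let ringR := base_subring R.
Let gradR := base_graded gradedR.
Local Notation F := {fraction R}.
Local Notation D := (gr_quotient G (base R)).

Lemma hSpec0 S : is_subring S -> hSpec G S [set 0].
Proof.
move=> ringS; split; first exact: prime0.
by apply: ideal_graded0 => a; case: gradF.
Qed.

(** The graded quotient field is the homogeneous localization at the zero
    ideal. *)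
Lemma gr_quotient_subring : is_subring D.
Proof. by apply: gr_loc_subring => //; apply: hSpec0. Qed.

Lemma graded_sub_gr_quotient S : graded (frac_deg G) S -> S `<=` D.
Proof.
move=> gradS; apply: (graded_sub gradS).
  exact: subring_additive gr_quotient_subring.
by move=> a x Gx _; apply: gr_quotient_homogeneous => //; exists a.
Qed.

(** A pair of a ring [V] and an ideal [I], encoded as one subset of
    [F * bool] so that Zorn's lemma for inclusion applies. The ideal witnesses
    that [m] stays proper in [V], a condition that is preserved by unions of
    chains. *)
Definition dominating_pair (A m : set F) (X : set (F * bool)) : Prop :=
  let V := [set x | X (x, true)] in let I := [set x | X (x, false)] in
  [/\ is_subring V, graded (frac_deg G) V, A `<=` V & 
   [/\ ideal V I, ~ I 1 & m `<=` I]].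

(** In a maximal pair [(V, I)], if neither [x] nor [x^-1] is in [V], then [1] is
    in both [I[x]] and [I[x^-1]] by maximality, contrary to
    [adjoin_exchange]. *)
Lemma gr_valuation_overring (A m : set F) : is_subring A ->
  graded (frac_deg G) A -> prime_ideal A m ->
  exists V I, [/\ is_subring V, graded (frac_deg G) V, A `<=` V,
    [/\ ideal V I, ~ I 1 & m `<=` I]
    & forall a x, frac_deg G a x -> x != 0 -> V x \/ V x^-1].
Proof.
move=> ringA gradA primem; have [idm m1 _] := primem.
pose pair (V I : set F) := [set z : F * bool | if z.2 then V z.1 else I z.1].
have pair0 : dominating_pair A m (pair A m).
  split; [exact: ringA|exact: gradA|by move=> ?|].
  by split; [exact: idm|exact: m1|move=> ?].
have [C [X0 CX0] Ctot CP|] := zorn_above pair0.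
  have C2 z t : (\bigcup_(X in C) X) z -> (\bigcup_(X in C) X) t ->
      exists X, [/\ C X, X z & X t].
    move=> [X CX Xz] [Y CY Yt]; case: (Ctot X Y CX CY) => sXY.
      by exists Y; split=> //; apply: sXY.
    by exists X; split=> //; apply: sXY.
  have [ring0 _ sA0 [id0 _ sm0]] := CP X0 CX0.
  split; [|move=> x [X CX Xx]|by move=> x /sA0; exists X0|split; first split].
  - apply/is_subringP; split.
    + by exists X0 => //; apply: subring1 ring0.
    + move=> x y Ux Uy; have [X [CX Xx Xy]] := C2 _ _ Ux Uy.
      by exists X => //; have [ringX _ _ _] := CP X CX; apply: (subringB ringX).
    + move=> x y Ux Uy; have [X [CX Xx Xy]] := C2 _ _ Ux Uy.
      by exists X => //; have [ringX _ _ _] := CP X CX; apply: (subringM ringX).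
  - have [_ gradX _ _] := CP X CX; have [s [f [Gf defx]]] := gradX x Xx.
    exists s, f; split=> // a; have [Ga Xa] := Gf a.
    by split=> //; exists X.
  - move=> x [X CX Xx]; exists X => //; have [_ _ _ [idX _ _]] := CP X CX.
    exact: (ideal_sub idX).
  - by exists X0 => //; apply: (ideal0 id0).
  - move=> x y Ux Uy; have [X [CX Xx Xy]] := C2 _ _ Ux Uy.
    by exists X => //; have [_ _ _ [idX _ _]] := CP X CX; apply: (idealD idX).
  - move=> a x Ua Ux; have [X [CX Xa Xx]] := C2 _ _ Ua Ux.
    by exists X => //; have [_ _ _ [idX _ _]] := CP X CX; apply: (ideal_mull idX).
  - by move=> [X CX]; have [_ _ _ [_ X1 _]] := CP X CX; apply: X1.
  - by move=> x mx; exists X0 => //; apply: sm0.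
move=> M [[ringV gradV sAV [idI I1 smI]] _ Mmax].
set V := [set x | M (x, true)] in ringV gradV sAV idI.
set I := [set x | M (x, false)] in idI I1 smI.
have V0 := subring0 ringV; have V1 := subring1 ringV.
have I0 := ideal0 idI.
have extend a x : frac_deg G a x -> ~ V x -> adjoin I x 1.
  move=> Gx nVx; apply: contrapT => nI1; apply: nVx.
  rewrite /V /= -(Mmax (pair (adjoin V x) (adjoin I x))).
  - exact: mem_adjoin.
  - split; [exact: adjoin_subring|exact: (adjoin_graded gradF ringV gradV Gx)| |].
      by move=> z /sAV Vz; apply: (sub_adjoin x V0 Vz).
    split; [exact: adjoin_ideal|exact: nI1|].
    by move=> z /smI Iz; apply: (sub_adjoin x I0 Iz).
  - by move=> [z []] Mz; [apply: (sub_adjoin x V0 Mz)|apply: (sub_adjoin x I0 Mz)].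
exists V, I; split=> // a x Gx x0; apply: contrapT => /not_orP[nVx nVxV].
apply: I1; apply: (adjoin_exchange ringV idI x0); first exact: extend Gx nVx.
by apply: extend (frac_degV Gx x0) nVxV.
Qed.

Section ValuationRing.
Variable V : set F.
Hypothesis ringV : is_subring V.
Hypothesis valV : forall a x, frac_deg G a x -> x != 0 -> V x \/ V x^-1.

(** The graded ideals of a graded valuation ring are totally ordered. *)
Lemma gr_valuation_local : gr_local G V.
Proof.
have [M maxM _] := gr_maximal_above ringV (hSpec_proper ringV (hSpec0 ringV)).
exists M; split=> // N maxN.
have witness M1 M2 : gr_maximal G V M1 -> gr_maximal G V M2 -> ~ M1 `<=` M2 ->
    exists a x, [/\ frac_deg G a x, M1 x & ~ M2 x].
  move=> [[_ gradM1 _] _] [[idM2 _ _] _] nsM; apply: contrapT => no; apply: nsM.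
  apply: (graded_sub gradM1); first exact: ideal_additive idM2.
  by move=> a x Gx M1x; apply: contrapT => nM2x; apply: no; exists a, x.
have [propM Mmax] := maxM; have [propN Nmax] := maxN.
have [sMN|nsMN] := pselect (M `<=` N); first by rewrite (Mmax N).
have [sNM|nsNM] := pselect (N `<=` M); first by rewrite (Nmax M).
have [a [x [Gx Mx nNx]]] := witness _ _ maxM maxN nsMN.
have [b [y [Gy Ny nMy]]] := witness _ _ maxN maxM nsNM.
have [[idM _ _] [idN _ _]] := (propM, propN).
have x0 : x != 0 by apply/eqP => x0; apply: nNx; rewrite x0; apply: ideal0 idN.
have y0 : y != 0 by apply/eqP => y0; apply: nMy; rewrite y0; apply: ideal0 idM.
have [_ _ GM _] := gradF.
have [|Vxy|Vyx] := valV (GM _ _ _ _ Gx (frac_degV Gy y0)).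
- by rewrite mulf_neq0 ?invr_eq0.
- by case: nNx; rewrite -(divfK y0 x); apply: (ideal_mull idN).
- by case: nMy; rewrite -(divfK x0 y) -invf_div; apply: (ideal_mull idM).
Qed.

End ValuationRing.

(** ** Perinormality implies the graded condition [R_1] *)

(** A graded valuation overring [V] of the localization at [P], centred on [P],
    has going-down because the only graded primes of [R] inside [P] are [P] and
    [0]. So it is a localization of [R] and is contained in the homogeneous
    localization at [P]. *)
Lemma perinormal_R1 : graded_perinormal G -> gr_R1 G.
Proof.
move=> perG P [specP [_ htP]].
have [primeP gradP] := specP; have idP := prime_ideal_ideal primeP.
pose A := gr_loc G (base R) P.
have ringA : is_subring A by apply: gr_loc_subring.
have gradA : graded (frac_deg G) A by apply: gr_loc_graded.
have sRA : base R `<=` A by apply: sub_gr_loc.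
have [m [primem gradm] capm] := extended_hSpec gradedR specP specP (fun _ => id).
have [V [I [ringV gradV sAV [idI I1 smI] valV]]] :=
  gr_valuation_overring ringA gradA primem.
have sRV := subset_trans sRA sAV.
have locV := gr_valuation_local ringV valV.
have [N [maxN _]] := locV.
have specN := gr_maximal_prime gradedR ringV gradV maxN.
have [[idN N1 _] gradN] := specN.
have capN : N `&` base R = P.
  apply/seteqP; split.
    exact: (contraction_sub_center gradedR specP ringV sAV).
  have addN := ideal_additive ringV idN.
  suff sPN : P `<=` N by move=> x Px; split; [apply: sPN|apply: ideal_sub Px].
  apply: (graded_sub gradP addN) => a x Gx Px; apply: contrapT => nNx; apply: I1.
  have x0 : x != 0 by apply/eqP => x0; apply: nNx; rewrite x0; apply: ideal0 idN.
  have Vx : V x by apply/sRV/(ideal_sub idP).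
  have VxV : V x^-1.
    by apply: (gr_local_unit gradedR ringV gradV locV maxN) => //; exists a.
  rewrite -(mulVf x0); apply: (ideal_mull idI) => //; apply: smI.
  by have : (m `&` base R) x; [rewrite capm|case].
have below Q : hSpec G (base R) Q -> Q `<=` P -> Q = P \/ Q = [set 0].
  move=> [primeQ _] sQP; apply: contrapT => /not_orP[nQP nQ0].
  have lt0Q : [set 0] `<` Q.
    split=> [_ ->|sQ0]; first exact: ideal0 (prime_ideal_ideal primeQ).
    apply: nQ0; apply/seteqP; split=> // _ ->.
    exact: ideal0 (prime_ideal_ideal primeQ).
  have ltQP : Q `<` P by split=> // sPQ; apply: nQP; apply/seteqP.
  pose C i := match i with 0%N => [set 0] | 1%N => Q | _ => P end.
  suff : (2 <= 1)%N by [].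
  apply: (htP 2%N C) => //; split=> [[|[|i]] _|[|[|i]]] //; exact: prime0.
have [| | |W multW defV] := perG V.
- split=> //; exact: graded_sub_gr_quotient.
- exact: locV.
- move=> P1 Q1 Q' specP1 specQ1 specQ' sPQ1 capQ'.
  have sQ'N : Q' `<=` N.
    by apply: (gr_local_sub ringV locV maxN); apply: hSpec_proper specQ'.
  have sQ1P : Q1 `<=` P by rewrite -capQ' -capN; apply: setSI.
  have [eqP1|->] := below P1 specP1 (subset_trans sPQ1 sQ1P).
    exists Q'; split=> //; rewrite capQ'; apply/seteqP; split=> //.
    by rewrite eqP1.
  exists [set 0]; split; first exact: hSpec0.
    by move=> _ ->; case: specQ' => -[/ideal0].
  by apply/seteqP; split=> [z []//|_ ->]; split=> //; apply: subring0.
have sVA : V `<=` A.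
  rewrite /A -capN.
  exact: (graded_localization_sub gradedR ringV gradV sRV multW defV specN).
move=> x _ [a Gx] /eqP x0.
by case: (valV a x Gx x0) => /sVA; [left|right].
Qed.

(** ** Perinormality excludes overrings with the same graded spectrum *)

Lemma reflecting_bij_refl A : is_subring A -> hSpec_reflecting_bij G A A.
Proof.
move=> ringA.
have capA Q : hSpec G A Q -> contraction A Q = Q.
  by move=> [[idQ _ _] _]; apply: setIidl; apply: ideal_sub.
split; first split.
- by move=> Q specQ; rewrite capA.
- by move=> P Q /set_mem specP /set_mem specQ; rewrite !capA.
- by move=> Q specQ; exists Q => //; apply: capA.
- by move=> P Q specP specQ; rewrite !capA.
Qed.

(** Let [M] be the prime of [S] over the graded maximal ideal of the
    localization. Order reflection makes [M] the largest graded prime of [S],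
    and with surjectivity it provides going-down. *)
Lemma perinormal_unique p S : graded_perinormal G -> hSpec G (base R) p ->
  graded_between G (gr_loc G (base R) p) D S ->
  hSpec_reflecting_bij G (gr_loc G (base R) p) S ->
  S = gr_loc G (base R) p.
Proof.
move=> perG specp; set A := gr_loc G (base R) p.
move=> [ringS gradS sAS sSD] [[_ _ surj] reflect].
have ringA : is_subring A by apply: gr_loc_subring.
have sRA : base R `<=` A by apply: sub_gr_loc.
have sRS := subset_trans sRA sAS.
have capRA Q : Q `&` base R = (Q `&` A) `&` base R.
  by rewrite -setIA [A `&` _]setIidr.
have [m specm capm] := extended_hSpec gradedR specp specp (fun _ => id).
have [M specM capM] := surj m specm.
have capMR : M `&` base R = p by rewrite capRA -[M `&` A]/(contraction A M) capM.
have idm : ideal A m by case: specm => -[].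
have Mmax Q : hSpec G S Q -> Q `<=` M.
  move=> specQ; apply: reflect => //; rewrite capM.
  have [[idQ Q1 _] gradQ] := specQ.
  have sQp := contraction_sub_center gradedR specp ringS sAS idQ gradQ Q1.
  apply: (gr_loc_ideal_sub gradedR specp idQ idm ringA sRS) => //.
  by move=> x /sQp; rewrite -capm => -[].
have properM := hSpec_proper ringS specM.
have maxM : gr_maximal G S M.
  split=> // J propJ sMJ; have [N maxN sJN] := gr_maximal_above ringS propJ.
  apply/seteqP; split=> //; apply: subset_trans sJN _; apply: Mmax.
  exact: (gr_maximal_prime gradedR ringS gradS maxN).
have locS : gr_local G S.
  exists M; split=> // N maxN; have [_ Nmax] := maxN.
  apply: Nmax => //; apply: Mmax.
  exact: (gr_maximal_prime gradedR ringS gradS maxN).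
have [| | |W multW defS] := perG S.
- by split.
- exact: locS.
- move=> P Q Q' specP specQ specQ' sPQ capQ'.
  have sQp : Q `<=` p by rewrite -capQ' -capMR; apply: setSI; apply: Mmax.
  have [P0 specP0 capP0] :=
    extended_hSpec gradedR specp specP (subset_trans sPQ sQp).
  have [P' specP' capP'] := surj P0 specP0.
  exists P'; split=> //; last by rewrite capRA -[P' `&` A]/(contraction A P') capP'.
  have [[[idQ' _ _] _] [[idP0 _ _] _]] := (specQ', specP0).
  apply: reflect => //; rewrite capP' => x P0x.
  have Ax := ideal_sub idP0 P0x; split=> //.
  apply: (gr_loc_ideal_sub gradedR specp idP0 idQ' ringS sRA sAS) => //.
  by rewrite capP0 => z /sPQ; rewrite -capQ' => -[].
apply/seteqP; split=> //; rewrite /A -capMR.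
exact: (graded_localization_sub gradedR ringS gradS sRS multW defS specM).
Qed.

Lemma only_between_integral p : hSpec G (base R) p ->
  only_between G (gr_loc G (base R) p) D ->
  only_between G (gr_loc G (base R) p)
    (integral_closure (gr_loc G (base R) p)).
Proof.
move=> specp; set A := gr_loc G (base R) p => onlyA.
have ringA : is_subring A by apply: gr_loc_subring.
apply/seteqP; split=> [S [[ringS gradS sAS _] bijS]|_ ->].
  rewrite -onlyA; split=> //; split=> //.
  exact: graded_sub_gr_quotient.
split; last exact: reflecting_bij_refl.
by split=> //; [apply: gr_loc_graded|apply: sub_integral_closure].
Qed.

End Perinormal.

(** * Overrings with graded going-down *)

Section GoingDown.
Variables (R : idomainType) (G : int -> set R).
Hypotheses (gradedR : grading G) (noethR : noetherian R).
Hypotheses (ucatR : universally_catenary R) (R1 : gr_R1 G).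
Let gradF := frac_deg_pieces gradedR.
Let ringR := base_subring R.
Let gradR := base_graded gradedR.
Local Notation F := {fraction R}.

(** The principal ideal theorem bounds the height of a minimal prime over [y],
    and catenarity carries the bound to [R]. *)
Lemma height_one_contraction (a : int) (y : F) (Q : set F) :
  frac_deg G a y -> y != 0 -> prime_ideal (adjoin (base R) y) Q -> Q y ->
  exists q, [/\ prime_ideal (adjoin (base R) y) q, q y, q `<=` Q
              & hSpec1 G (base R) (q `&` base R)].
Proof.
move=> Gy y0 primeQ Qy; have [q minq sqQ] := minimal_over_exists primeQ Qy.
have [primeq qy _] := minq; exists q; split=> //.
have ringT := adjoin_subring y ringR.
have gradT := adjoin_graded gradF ringR gradR Gy.
have sRT : base R `<=` adjoin (base R) y.
  by apply: sub_adjoin; apply: subring0.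
split.
  apply: (hSpec_contraction gradedR ringT ringR gradR sRT); split=> //.
  exact: (minimal_over_graded gradF ringT gradT Gy minq).
have [b [c [g [f [_ _ f0 _ defy]]]]] := Gy.
apply: (height_contraction ucatR f0 defy y0 primeq qy).
have maxT : max_condition (adjoin (base R) y) by apply: adjoin_max_condition.
by move=> p; apply: (krull_principal_ideal ringT maxT minq).
Qed.

(** The localization at the height one contraction is a graded valuation ring.
    It cannot contain [y^-1 = u / s], for then [s = u * y] would be in the
    prime; so it contains [y = u / s], and [u = y * s] is in the prime. *)
Lemma height_one_fraction (a : int) (y : F) (Q : set F) :
  frac_deg G a y -> y != 0 -> prime_ideal (adjoin (base R) y) Q -> Q y ->
  exists p u s, [/\ hSpec1 G (base R) p, p `<=` Q, p u
                  & [/\ base R s, ~ p s & y * s = u]].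
Proof.
move=> Gy y0 primeQ Qy.
have [q [primeq qy sqQ ht1]] := height_one_contraction Gy y0 primeQ Qy.
have sRT : base R `<=` adjoin (base R) y.
  by apply: sub_adjoin; apply: subring0.
have idq := prime_ideal_ideal primeq.
have [specp _] := ht1.
have nz s : ~ (q `&` base R) s -> s != 0.
  move=> nqs; apply/eqP => s0; apply: nqs; rewrite s0.
  by split; [apply: ideal0 idq|apply: subring0].
exists (q `&` base R).
have [|| |[u Ru [s [Rs _ nqs] defy]]|[u Ru [s [Rs _ nqs] defy]]] := R1 ht1 (x := y).
- by apply: gr_quotient_homogeneous => //; [apply: sub_gr_loc|exists a].
- by exists a.
- exact/eqP.
- exists (y * s), s; split=> //; first by move=> z [/sqQ].
  split; first by apply: (ideal_mulr idq) => //; apply: sRT.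
  by rewrite -defy divfK ?nz.
- have defu : u = y^-1 * s by rewrite -defy divfK ?nz.
  case: nqs; split=> //; have -> : s = u * y by rewrite defu mulrAC mulVf ?mul1r.
  by apply: (ideal_mull idq) => //; apply: sRT.
Qed.

Section Overring.
Variable S : set F.
Hypotheses (ringS : is_subring S) (gradS : graded (frac_deg G) S).
Hypotheses (sRS : base R `<=` S) (gdS : gGD G (base R) S).

(** With [y = u / s] homogeneous in [Q1], going-down from [Q2] gives a prime of
    [S] below [Q2] containing [u] but not [s], hence containing [y]. *)
Lemma gGD_order_reflecting Q1 Q2 : hSpec G S Q1 -> hSpec G S Q2 ->
  Q1 `&` base R `<=` Q2 -> Q1 `<=` Q2.
Proof.
move=> specQ1 specQ2 sQ12; have [[primeQ1 gradQ1] [primeQ2 _]] := (specQ1, specQ2).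
have [idQ1 idQ2] := (prime_ideal_ideal primeQ1, prime_ideal_ideal primeQ2).
apply: (graded_sub gradQ1); first exact: ideal_additive idQ2.
move=> a y Gy Q1y; have Sy := ideal_sub idQ1 Q1y.
have [->|y0] := eqVneq y 0; first exact: ideal0 idQ2.
have ringT := adjoin_subring y ringR.
have sTS : adjoin (base R) y `<=` S by apply: adjoin_min.
have primeQ : prime_ideal (adjoin (base R) y) (Q1 `&` adjoin (base R) y).
  exact: prime_contraction sTS.
have Qy : (Q1 `&` adjoin (base R) y) y.
  by split=> //; apply: mem_adjoin; [apply: subring0|apply: subring1].
have [p [u [s [[specp _] spQ pu [Rs nps defu]]]]] :=
  height_one_fraction Gy y0 primeQ Qy.
have specQ2R := hSpec_contraction gradedR ringS ringR gradR sRS specQ2.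
have idp : ideal (base R) p by case: specp => -[].
have [|P' [[primeP' _] sP'Q2 capP']] := gdS specp specQ2R specQ2 _ erefl.
  move=> z pz; have Rz := ideal_sub idp pz; split=> //; apply: sQ12.
  by split=> //; case: (spQ z pz).
apply: sP'Q2; have [_ _ PM] := primeP'.
have : P' (y * s) by move: pu; rewrite -defu -capP' => -[].
case/(PM _ _ Sy (sRS Rs)) => // P's; case: nps; rewrite -capP'.
by split.
Qed.

(** If [x^-1] generates a proper ideal of [A[x^-1]], write [x^-1 = u / s] with
    [u] in a height one prime below the centre of [S]; then [s = x * u] lies in
    the prime of [S] over it that going-down provides. *)
Lemma gGD_integral M : gr_local G S -> gr_maximal G S M ->
  S `<=` integral_closure (gr_loc G (base R) (M `&` base R)).
Proof.
move=> locS maxM; have specM := gr_maximal_prime gradedR ringS gradS maxM.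
have specp := hSpec_contraction gradedR ringS ringR gradR sRS specM.
set p := M `&` base R in specp *; set A := gr_loc G (base R) p.
have ringA : is_subring A by apply: gr_loc_subring.
have gradA : graded (frac_deg G) A by apply: gr_loc_graded.
have sRA : base R `<=` A by apply: sub_gr_loc.
apply: (graded_sub gradS); first exact: integral_closure_additive.
move=> a x Gx Sx; have [->|x0] := eqVneq x 0.
  exact: (sub_integral_closure ringA (subring0 ringA)).
have Gy := frac_degV Gx x0; have y0 : x^-1 != 0 by rewrite invr_eq0.
pose B := adjoin A x^-1.
have ringB : is_subring B by apply: adjoin_subring.
have gradB : graded (frac_deg G) B := adjoin_graded gradF ringA gradA Gy.
have sAB : A `<=` B by apply: sub_adjoin (subring0 ringA).
have By : B x^-1 by apply: mem_adjoin (subring0 ringA) (subring1 ringA).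
have [[b Bb yb1]|ny1] := pselect ([set x^-1 * b | b in B] 1).
  have defb : b = x by rewrite -[x]mulr1 -yb1 mulVKf.
  by move: Bb; rewrite defb; apply: integral_inverse.
have properB : graded_proper_ideal G B [set x^-1 * b | b in B].
  apply: graded_proper_idealP => //; first exact: ideal_principal.
  exact: (principal_graded gradedR ringB gradB Gy By).
have [N maxN sN] := gr_maximal_above ringB properB.
have [primeN gradN] := gr_maximal_prime gradedR ringB gradB maxN.
have [idN N1 _] := primeN.
have Ny : N x^-1 by apply: sN; exists 1; [apply: subring1|rewrite mulr1].
have sTB : adjoin (base R) x^-1 `<=` B.
  by apply: adjoin_min => //; apply: subset_trans sAB.
have ringT := adjoin_subring x^-1 ringR.
have primeQ : prime_ideal (adjoin (base R) x^-1) (N `&` adjoin (base R) x^-1).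
  exact: prime_contraction sTB.
have Qy : (N `&` adjoin (base R) x^-1) x^-1.
  by split=> //; apply: mem_adjoin; [apply: subring0|apply: subring1].
have [p1 [u [s [[specp1 _] sp1Q p1u [Rs np1s defu]]]]] :=
  height_one_fraction Gy y0 primeQ Qy.
have idp1 : ideal (base R) p1 by case: specp1 => -[].
have sp1p : p1 `<=` p.
  move=> z p1z; apply: (contraction_sub_center gradedR specp ringB sAB idN gradN N1).
  by split; [case: (sp1Q z p1z)|apply: ideal_sub p1z].
have [P' [[[idP' _ _] _] _ capP']] := gdS specp1 specp specM sp1p erefl.
case: np1s; rewrite -capP'; split=> //.
have -> : s = x * u by rewrite -defu mulVKf.
apply: (ideal_mull idP') => //.
by move: p1u; rewrite -capP' => -[].
Qed.

(** Surjectivity is going-down from [M], whose contraction is the graded maximal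
    ideal of the localization. *)
Lemma gGD_reflecting_bij M : gr_local G S -> gr_maximal G S M ->
  gr_loc G (base R) (M `&` base R) `<=` S ->
  hSpec_reflecting_bij G (gr_loc G (base R) (M `&` base R)) S.
Proof.
move=> locS maxM; have specM := gr_maximal_prime gradedR ringS gradS maxM.
have specp := hSpec_contraction gradedR ringS ringR gradR sRS specM.
set p := M `&` base R in specp *; set A := gr_loc G (base R) p => sAS.
have ringA : is_subring A by apply: gr_loc_subring.
have gradA : graded (frac_deg G) A by apply: gr_loc_graded.
have sRA : base R `<=` A by apply: sub_gr_loc.
have reflect P Q : hSpec G S P -> hSpec G S Q ->
    contraction A P `<=` contraction A Q -> P `<=` Q.
  move=> specP specQ sPQ; apply: gGD_order_reflecting => // z [Pz Rz].
  by case: (sPQ z) => //; split=> //; apply: sRA.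
split=> //; split.
- by move=> Q specQ; apply: hSpec_contraction specQ.
- move=> P Q /set_mem specP /set_mem specQ eqPQ; apply/seteqP.
  by split; apply: reflect => //; rewrite eqPQ.
- move=> P0 specP0; have [[idP0 P01 _] gradP0] := specP0.
  have sP0p :=
    contraction_sub_center gradedR specp ringA (fun _ => id) idP0 gradP0 P01.
  have specP := hSpec_contraction gradedR ringA ringR gradR sRA specP0.
  have [P' [specP' _ capP']] := gdS specP specp specM sP0p erefl.
  have idP' : ideal S P' by case: specP' => -[].
  exists P' => //; apply/seteqP; split.
    apply: (gr_loc_ideal_sub gradedR specp idP' idP0 ringA sRS) => //.
    by rewrite capP' => z [].
  move=> z P0z; have Az := ideal_sub idP0 P0z; split=> //.
  apply: (gr_loc_ideal_sub gradedR specp idP0 idP' ringS sRA sAS) => //.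
  by rewrite -capP' => t [].
Qed.

End Overring.

Lemma only_between_perinormal :
  (forall p, hSpec G (base R) p ->
     only_between G (gr_loc G (base R) p)
       (integral_closure (gr_loc G (base R) p))) ->
  graded_perinormal G.
Proof.
move=> only S [ringS gradS sRS sSD] locS gdS; have [M [maxM _]] := locS.
have specM := gr_maximal_prime gradedR ringS gradS maxM.
have specp := hSpec_contraction gradedR ringS ringR gradR sRS specM.
set p := M `&` base R in specp *.
have sAS : gr_loc G (base R) p `<=` S.
  apply: (gr_loc_min ringS sRS) => w Rw hw npw.
  apply: (gr_local_unit gradedR ringS gradS locS maxM (sRS w Rw) hw) => Mw.
  by apply: npw.
exists (homogeneous_complement G p).
  by apply: homogeneous_complement_mult => //; case: specp.
suff : [set gr_loc G (base R) p] S by [].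
rewrite -(only p specp); split; last exact: gGD_reflecting_bij.
by split=> //; apply: gGD_integral.
Qed.

End GoingDown.

Theorem theorem2p25 (R : idomainType) (G : int -> set R) (gradedR : grading G)
    (noethR : noetherian R) (ucatR : universally_catenary R) :
  [<-> graded_perinormal G;
       gr_R1 G /\
       (forall p, hSpec G (base R) p ->
          only_between G (gr_loc G (base R) p) (gr_quotient G (base R)));
       gr_R1 G /\
       (forall p, hSpec G (base R) p ->
          only_between G (gr_loc G (base R) p)
            (integral_closure (gr_loc G (base R) p)))].
Proof.
tfae.
- move=> perG; split; first exact: (perinormal_R1 gradedR).
  move=> p specp; apply/seteqP; split=> [S [betS bijS]|_ ->].
    exact: (perinormal_unique gradedR perG specp betS bijS).
  have ringA := gr_loc_subring gradedR specp.
  have gradA := gr_loc_graded gradedR specp.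
  split; last exact: reflecting_bij_refl.
  by split=> //; apply: graded_sub_gr_quotient.
- move=> [R1 only]; split=> // p specp.
  exact: (only_between_integral gradedR specp (only p specp)).
- by move=> [R1 only]; apply: only_between_perinormal.
Qed.
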